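(* Let $F$ be an inverted concave distribution function, i.e. $F\in\mathcal H$. Then $F$ satisfies property (SD): for every integer $n\ge 2$, if $X_1,\dots,X_n$ are independent and identically distributed with distribution function $F$, then $$\sum_{i=1}^n\eta_iX_i\le_{\rm st}\sum_{i=1}^n\theta_iX_i$$ for all $\overline\theta=(\theta_1,\dots,\theta_n)$ and $\overline\eta=(\eta_1,\dots,\eta_n)$ in $\mathbb R_+^n$ such that $\overline\theta\preceq\overline\eta$.
   Context: $\mathbb R_+=[0,\infty)$ and $\mathbb R_{++}=(0,\infty)$. For a distribution function $F$, $\overline F=1-F$ and $\operatorname{ess\,inf}F$ denotes its essential infimum. Inverted concave: a distribution function $F$ with $\operatorname{ess\,inf}F=0$ is inverted concave, written $F\in\mathcal H$, if $x\mapsto\overline F(1/x)$ is concave on $\mathbb R_{++}$. Usual stochastic order: $X\le_{\rm st}Y$ means $\mathbb P(X\le x)\ge\mathbb P(Y\le x)$ for all $x\in\mathbb R$. Majorization order: for $\overline\theta,\overline\eta\in\mathbb R^n$, let $\theta_{(i)}$ denote the $i$-th smallest coordinate of $\overline\theta$ (likewise $\eta_{(i)}$). Then $\overline\theta\preceq\overline\eta$ means $\sum_{i=1}^k\theta_{(i)}\ge\sum_{i=1}^k\eta_{(i)}$ for all $k\in\{1,\dots,n\}$ and $\sum_{i=1}^n\theta_i=\sum_{i=1}^n\eta_i$. *)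

(* Defs.v *)
From HB Require Import structures.
From mathcomp Require Import all_boot all_order all_algebra.
From mathcomp Require Import all_classical all_reals all_analysis.
From mathcomp Require Import measurable_realfun ess_sup_inf.

Set Implicit Arguments.
Unset Strict Implicit.
Unset Printing Implicit Defensive.

Import Order.TTheory GRing.Theory Num.Theory.
Import numFieldNormedType.Exports.

Local Open Scope classical_set_scope.
Local Open Scope convex_scope.
Local Open Scope ring_scope.

(* Reverse inequality of the library's [convex_function]. *)
Definition concave_function (R : numFieldType) (E : lmodType R)
    (E' := convex_lmodType E) (D : set E') (f : E' -> R^o) : Prop :=
  forall t : {i01 R},
    {in D &, forall x y : E', f x <| t |> f y <= f (x <| t |> y)}.

(* [cumulativeBounded 0 1] is the type of distribution functions on the real
   line: nondecreasing, right-continuous, with limits 0 at -oo and 1 at +oo.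
   The essential infimum is that of the identity under the law with
   distribution function F. *)
Definition ess_inf_df (R : realType) (F : cumulativeBounded (0 : R) (1 : R)) :
    \bar R :=
  ess_inf (lebesgue_stieltjes_measure F) (@EFin R).

Definition inverted_concave (R : realType)
    (F : cumulativeBounded (0 : R) (1 : R)) : Prop :=
  ess_inf_df F = 0%E /\
  @concave_function R R^o [set x : R | 0 < x] (fun x : R => 1 - F x^-1).

(* X and Y may live on different probability spaces. *)
Definition le_st (R : realType) (d d' : measure_display)
    (T : measurableType d) (T' : measurableType d')
    (P : probability T R) (P' : probability T' R)
    (X : {RV P >-> R}) (Y : {RV P' >-> R}) : Prop :=
  forall x : R, (cdf Y x <= cdf X x)%E.

(* Coordinates sorted in nondecreasing order: the i-th smallest coordinate of v
   (with multiplicity) is at position i.-1. *)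
Definition order_stats (R : realType) (n : nat) (v : 'rV[R]_n) : seq R :=
  sort <=%R [seq v 0 i | i <- enum 'I_n].

(* [majorized theta eta] is theta \preceq eta: eta is the more spread out. *)
Definition majorized (R : realType) (n : nat) (theta eta : 'rV[R]_n) : Prop :=
  (forall k : nat, (1 <= k <= n)%N ->
     \sum_(i < k) nth 0 (order_stats eta) i
       <= \sum_(i < k) nth 0 (order_stats theta) i) /\
  \sum_(i < n) theta 0 i = \sum_(i < n) eta 0 i.

Definition independent_RVs (R : realType) (d : measure_display)
    (T : measurableType d) (P : probability T R) (I : finType)
    (X : I -> {RV P >-> R}) : Prop :=
  forall (J : {set I}) (A : I -> set R), (forall i, measurable (A i)) ->
    P (\bigcap_(i in [set i | i \in J]) (X i @^-1` A i))
    = (\prod_(i in J) P (X i @^-1` A i))%E.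

Definition iid_with_df (R : realType) (d : measure_display)
    (T : measurableType d) (P : probability T R) (I : finType)
    (F : R -> R) (X : I -> {RV P >-> R}) : Prop :=
  independent_RVs X /\ forall i x, cdf (X i) x = (F x)%:E.

Definition weighted_sum (R : realType) (d : measure_display)
    (T : measurableType d) (n : nat) (a : 'rV[R]_n)
    (X : 'I_n -> {mfun T >-> R}) : T -> R :=
  fun w => \sum_(i < n) a 0 i * X i w.

Lemma measurable_weighted_sum (R : realType) (d : measure_display)
    (T : measurableType d) (n : nat) (a : 'rV[R]_n)
    (X : 'I_n -> {mfun T >-> R}) :
  measurable_fun [set: T] (weighted_sum a X).
Proof.
rewrite /weighted_sum; apply: measurable_sum => i.
by apply: measurable_funM => //; exact: measurable_cst.
Qed.

HB.instance Definition _ (R : realType) (d : measure_display)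
    (T : measurableType d) (n : nat) (a : 'rV[R]_n)
    (X : 'I_n -> {mfun T >-> R}) :=
  isMeasurableFun.Build _ _ _ _ (weighted_sum a X)
    (measurable_weighted_sum a X).

Definition property_SD (R : realType) (F : R -> R) : Prop :=
  forall (n : nat) (d : measure_display) (T : measurableType d)
    (P : probability T R) (X : 'I_n -> {RV P >-> R}),
  (2 <= n)%N -> iid_with_df F X ->
  forall theta eta : 'rV[R]_n,
  (forall i, 0 <= theta 0 i) -> (forall i, 0 <= eta 0 i) ->
  majorized theta eta ->
  le_st (weighted_sum eta X : {RV P >-> R})
        (weighted_sum theta X : {RV P >-> R}).

(* Main.v *)
From HB Require Import structures.
Require Import Defs.
From mathcomp Require Import all_boot all_order all_algebra.
From mathcomp Require Import fingroup perm.
From mathcomp Require Import all_classical all_reals all_analysis.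
From mathcomp Require Import measurable_realfun ess_sup_inf ring lra.

(** A vector theta is majorized by eta exactly when theta is reached from eta
    by permutations and transfers that move two coordinates closer to each
    other while keeping their sum ([transfer_perm], [transfer_majorized]).
    Conditionally on the other summands ([weighted_sum_split]), such a step only
    concerns two independent copies X and Y of the variable, and the theorem
    reduces to [pair_prob_spread]: if 0 <= p <= p' <= q' <= q and
    p + q = p' + q', then P(p'X + q'Y <= c) <= P(pX + qY <= c).

    Put G(u) = 1 - F(1/u), which is concave, and U = 1/X. Then G is the
    distribution function of U on the half-line, and the left slope g of G is a
    nonincreasing density of U; the mass of X at 0 sits at U = +oo. By the layer
    cake formula a nonincreasing density is a mixture of indicators of intervals
    ]0, a[. Hence an inequality between two integrals of nonnegative functions
    under the law of X holds as soon as it holds at x = 0 and for U uniform on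
    each ]0, a[ ([inverted_concave_le_integral]). Used once in each variable,
    this leaves an inequality between areas, besides easy one-dimensional ones for
    the mass at 0 ([inverted_concave_le_integral2]).

    For c = 1 the region is the part of the rectangle ]0, a[ x ]0, b[ where
    p/u + q/v <= 1, that is, where (u - p)(v - q) >= pq. Its area is
    pq (A - 1 - ln A) with A = (a - p)(b - q)/(pq), or 0 if A < 1
    ([halfplane_area]). As X and Y have the same law, only the sum of this area
    and of the one with p and q exchanged matters. If both regions are nonempty,
    the sum is, with s = pq and sg = p + q,

      2ab - sg (a + b) - s ln(1 + (a^2 - sg a)/s) - s ln(1 + (b^2 - sg b)/s),

    and every function s ln(1 + k/s) is nondecreasing in s, while s grows when p
    and q get closer. If one region is empty, the smaller side of the rectangle
    is at most sg, and there the other region shrinks as a set; the two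
    regimes are glued at the value of p at which the second region appears
    ([corner_area_spread]). *)

Set Implicit Arguments.
Unset Strict Implicit.
Unset Printing Implicit Defensive.

Import Order.TTheory GRing.Theory Num.Theory.
Import numFieldNormedType.Exports.

Local Open Scope classical_set_scope.
Local Open Scope ring_scope.

(** * Iterated integrals over a subset *)

Lemma fubini_tonelli_in d1 d2 (T1 : measurableType d1) (T2 : measurableType d2)
    (R : realType) (m1 : {sigma_finite_measure set T1 -> \bar R})
    (m2 : {sigma_finite_measure set T2 -> \bar R}) (D : set T1)
    (f : T1 * T2 -> \bar R) :
  measurable D -> measurable_fun [set: T1 * T2] f ->
  (forall z, 0 <= f z)%E ->
  measurable_fun [set: T2] (fun y => \int[m1]_(x in D) f (x, y))%E /\
  (\int[m1]_(x in D) \int[m2]_y f (x, y) =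
   \int[m2]_y \int[m1]_(x in D) f (x, y))%E.
Proof.
move=> mD mf f0; pose h := f \_ (D `*` [set: T2]).
have mDT : measurable (D `*` [set: T2]) by exact: measurableX.
have mh : measurable_fun [set: T1 * T2] h.
  by apply/(measurable_restrictT f mDT)/measurable_funTS.
have h0 z : (0 <= h z)%E by apply: erestrict_ge0 => x _; exact: f0.
have hE y : (\int[m1]_(x in D) f (x, y) = \int[m1]_x h (x, y))%E.
  rewrite integral_mkcond; apply: eq_integral => x _; rewrite /h !patchE.
  by rewrite in_setX in_setT andbT.
split.
  under eq_fun do rewrite hE.
  exact: (measurable_fun_fubini_tonelli_G h mh h0).
under [in RHS]eq_integral do rewrite hE.
rewrite -fubini_tonelli// integral_mkcond; apply: eq_integral => x _.
rewrite patchE; case: ifPn => xD.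
  by apply: eq_integral => y _; rewrite /h patchE in_setX in_setT xD.
apply/esym/integral0_eq => y _.
by rewrite /h patchE in_setX (negbTE xD).
Qed.

(** * Left slopes of a concave function *)

Lemma nonincreasing_pos_measurable {R : realType} (f : R -> R) :
  (forall u v, 0 < u -> u <= v -> f v <= f u) ->
  (forall u, u <= 0 -> f u = 0) -> measurable_fun [set: R] f.
Proof.
move=> f_ni f0; pose D : set R := `]0, +oo[%classic.
have -> : f = f \_ D.
  apply/funext => u; rewrite patchE mem_setE/= in_itv/= andbT.
  by case: ltP => // /f0.
have mD : measurable D by exact: measurable_itv.
apply/(measurable_restrictT f mD).
apply: (measurability (@RGenCInfty.G R)) => [|/= _ [_] [r] -> <-].
  exact: RGenCInfty.measurableE.
apply: is_interval_measurable => s t/=.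
rewrite /D/= !in_itv/= !andbT => -[s0 rs] [t0 rt] u /andP[su ut].
have u0 := lt_le_trans s0 su.
by split; rewrite ?in_itv/= ?u0// andbT (le_trans rt)// f_ni.
Qed.

Section left_slope.
Context {R : realType} (G : R -> R).
Hypothesis G_slope : forall w u v : R, 0 < w -> w < u -> u < v ->
  (G v - G u) / (v - u) <= (G u - G w) / (u - w).
Hypothesis G_nd : forall u v : R, 0 < u -> u <= v -> G u <= G v.

(** At an interior point of ]0, +oo[ the slopes to the left are nonnegative, as G
    is nondecreasing, so that the infimum always exists; concavity makes it the
    left derivative. *)
Definition left_slope (u : R) : R :=
  if 0 < u then inf [set (G u - G w) / (u - w) | w in `]0, u[] else 0.

Let has_lbound_slopes u : 0 < u ->
  has_lbound [set (G u - G w) / (u - w) | w in `]0, u[].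
Proof.
move=> u0; exists 0 => _ [w + <-]; rewrite /= in_itv/= => /andP[w0 wu].
by rewrite divr_ge0 ?subr_ge0 ?G_nd// ltW.
Qed.

Let slopes_neq0 u : 0 < u ->
  [set (G u - G w) / (u - w) | w in `]0, u[] !=set0.
Proof.
move=> u0; exists ((G u - G (u / 2)) / (u - u / 2)); exists (u / 2) => //=.
by rewrite in_itv/= divr_gt0//= ltr_pdivrMr// ltr_pMr// ltr1n.
Qed.

Lemma left_slope_ge0 u : 0 <= left_slope u.
Proof.
rewrite /left_slope; case: ifPn => // u0; apply: lb_le_inf.
  exact: slopes_neq0.
move=> _ [w + <-]; rewrite /= in_itv/= => /andP[w0 wu].
by rewrite divr_ge0 ?subr_ge0 ?G_nd// ltW.
Qed.

Lemma left_slope_le w u : 0 < w -> w <= u ->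
  left_slope u * (u - w) <= G u - G w.
Proof.
move=> w0; rewrite le_eqVlt => /predU1P[->|wu]; first by rewrite !subrr mulr0.
rewrite -ler_pdivlMr ?subr_gt0// /left_slope (lt_trans w0 wu).
apply: ge_inf; first exact/has_lbound_slopes/(lt_trans w0 wu).
by exists w => //=; rewrite in_itv/= w0.
Qed.

(** By concavity every chord to the right of u is less steep than every chord to
    its left. *)
Lemma left_slope_ge u v : 0 < u -> u <= v ->
  G v - G u <= left_slope u * (v - u).
Proof.
move=> u0; rewrite le_eqVlt => /predU1P[->|uv]; first by rewrite !subrr mulr0.
rewrite -ler_pdivrMr ?subr_gt0// /left_slope u0; apply: lb_le_inf.
  exact: slopes_neq0.
move=> _ [w + <-]; rewrite /= in_itv/= => /andP[w0 wu].
exact: G_slope.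
Qed.

Lemma left_slope_ni u v : 0 < u -> u <= v -> left_slope v <= left_slope u.
Proof.
move=> u0; rewrite le_eqVlt => /predU1P[->//|uv].
have uv0 : 0 < v - u by rewrite subr_gt0.
rewrite -(ler_pM2r uv0); apply: le_trans (left_slope_ge u0 (ltW uv)).
exact: left_slope_le u0 (ltW uv).
Qed.

Lemma measurable_left_slope : measurable_fun [set: R] left_slope.
Proof.
apply: nonincreasing_pos_measurable => [u v|u u0]; first exact: left_slope_ni.
by rewrite /left_slope ltNge u0.
Qed.

End left_slope.

(** Over n equal steps the errors telescope to (m a - m b) (b - a) / n. This
    replaces differentiability when a monotone slope m is integrated. *)
Lemma eq_of_squeezed_increments {R : realType} (H m : R -> R) (a b : R) :
  a <= b ->
  (forall x y, a <= x -> x <= y -> y <= b ->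
     `|H y - H x| <= (m x - m y) * (y - x)) ->
  H a = H b.
Proof.
move=> ab Hm; apply/esym/eqP; rewrite -subr_eq0 -normr_eq0.
set c := (m a - m b) * (b - a).
have Hn n : `|H b - H a| * n.+1%:R <= c.
  pose d := (b - a) / n.+1%:R; pose x i := a + i%:R * d.
  have d0 : 0 <= d by rewrite divr_ge0// subr_ge0.
  have xa : x 0 = a by rewrite /x mul0r addr0.
  have xb : x n.+1 = b by rewrite /x /d mulrC divfK ?pnatr_eq0// subrKC.
  have xD i : x i.+1 - x i = d by rewrite /x -natr1; ring.
  have x_nd i j : (i <= j)%N -> x i <= x j.
    by move=> ij; rewrite /x lerD2l ler_wpM2r// ler_nat.
  have -> : c = (\sum_(0 <= i < n.+1) (m (x i) - m (x i.+1)) * d) * n.+1%:R.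
    rewrite -mulr_suml; under eq_bigr do rewrite -opprB.
    by rewrite sumrN telescope_sumr// xa xb opprB /c /d -mulrA divfK ?pnatr_eq0.
  rewrite ler_wpM2r// -{1}xa -xb -(telescope_sumr (H \o x))//=.
  apply: (le_trans (ler_norm_sum _ _ _)).
  rewrite !big_mkord; apply: ler_sum => i _; rewrite -(xD i).
  by apply: Hm; [rewrite -xa x_nd|rewrite x_nd|rewrite -xb x_nd].
rewrite eq_le normr_ge0 andbT leNgt; apply/negP => H0.
have := Hn (Num.truncn (c / `|H b - H a|)).
by rewrite mulrC -ler_pdivlMr// leNgt truncnS_gt.
Qed.

(** Both the integral of g and the increment of G over [x, y] lie between
    g y (y - x) and g x (y - x), so that their difference has squeezed
    increments. *)
Lemma integral_nonincreasing_slope {R : realType} (G g : R -> R) (x y : R) :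
  measurable_fun [set: R] g -> (forall u, 0 <= g u) ->
  (forall u v, 0 < u -> u <= v -> g v <= g u) ->
  (forall u v, 0 < u -> u <= v -> g v * (v - u) <= G v - G u) ->
  (forall u v, 0 < u -> u <= v -> G v - G u <= g u * (v - u)) ->
  0 < x -> x <= y ->
  (\int[lebesgue_measure]_(u in `]x, y]) (g u)%:E)%E = (G y - G x)%:E.
Proof.
move=> mg g0 g_ni gG Gg x0 xy.
pose I v := (\int[lebesgue_measure]_(u in `]x, v]) (g u)%:E)%E.
have mgE (D : set R) : measurable_fun D (EFin \o g).
  by apply/measurable_funTS/measurable_EFinP.
have bounds u v : x <= u -> u <= v ->
    ((g v * (v - u))%:E <= \int[lebesgue_measure]_(t in `]u, v]) (g t)%:E
      <= (g u * (v - u))%:E)%E.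
  move=> xu uv; have u0 := lt_le_trans x0 xu.
  have luv : lebesgue_measure (`]u, v]%classic : set R) = (v - u)%:E.
    rewrite lebesgue_measure_itv/= lte_fin; case: ltP => // vu.
    by have -> : v = u by [apply/eqP; rewrite eq_le vu]; rewrite subrr.
  rewrite 2!EFinM -luv -!integral_cst//; apply/andP; split.
  - apply: ge0_le_integral => //=; [by move=> t _; rewrite lee_fin| |].
      exact: mgE.
    + move=> t; rewrite in_itv/= => /andP[ut tv].
      by rewrite lee_fin g_ni// (lt_trans u0).
  - apply: ge0_le_integral => //=; [by move=> t _; rewrite lee_fin| |].
      exact: mgE.
    + move=> t; rewrite in_itv/= => /andP[ut tv].
      by rewrite lee_fin g_ni// ltW.
have Iadd u v : x <= u -> u <= v ->
    I v = (I u + \int[lebesgue_measure]_(t in `]u, v]) (g t)%:E)%E.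
  move=> xu uv; rewrite /I.
  rewrite (@itv_bndbnd_setU _ _ _ (BRight u)) ?bnd_simp//.
  rewrite ge0_integral_setU//=; first exact: mgE.
  - by move=> t _; rewrite lee_fin.
  - apply/disj_setPRL => t /=; rewrite !in_itv/= => /andP[ut _] /andP[_].
    by rewrite leNgt ut.
have Ifin v : x <= v -> I v \is a fin_num.
  move=> xv; have /andP[lo hi] := bounds _ _ (lexx x) xv.
  by rewrite fin_numElt (lt_le_trans _ lo) ?ltNyr// (le_lt_trans hi) ?ltry.
have : (fine (I x) - G x) = (fine (I y) - G y).
  apply: (@eq_of_squeezed_increments _ (fun v => fine (I v) - G v) g) => //.
  move=> u v xu uv vy; have u0 := lt_le_trans x0 xu.
  have /andP[] := bounds _ _ xu uv.
  have E : (fine (I v))%:E =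
      (fine (I u) + fine (\int[lebesgue_measure]_(t in `]u, v]) (g t)%:E))%:E.
    rewrite EFinD !fineK ?Ifin ?(le_trans xu)//; first exact: Iadd.
    have /andP[lo hi] := bounds _ _ xu uv.
    by rewrite fin_numElt (lt_le_trans _ lo) ?ltNyr// (le_lt_trans hi) ?ltry.
  case: E => ->.
  have := gG _ _ u0 uv; have := Gg _ _ u0 uv.
  set J := (\int[_]_(t in _) _)%E => G1 G2 lo hi.
  have Jfin : J \is a fin_num.
    by rewrite fin_numElt (lt_le_trans _ lo) ?ltNyr// (le_lt_trans hi) ?ltry.
  move: lo hi; rewrite -(fineK Jfin) !lee_fin => lo hi.
  rewrite /= ler_norml; apply/andP; split; nra.
rewrite {1}/I set_itvoc0 integral_set0/= sub0r => E.
rewrite -/(I y) -(fineK (Ifin y xy)); congr EFin.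
by move: E => /eqP; rewrite -subr_eq0 => /eqP E; lra.
Qed.

(** * Integrals under an inverted concave law *)

(** Measurability is immediate for the inverse cut off at 0, since it is monotone
    on the positive half-line. *)
Definition pos_inv {R : realType} (x : R) : R := if 0 < x then x^-1 else 0.

Lemma measurable_pos_inv (R : realType) :
  measurable_fun [set: R] (@pos_inv R).
Proof.
apply: nonincreasing_pos_measurable => [u v u0 uv|u u0].
  by rewrite /pos_inv u0 (lt_le_trans u0 uv) lef_pV2// posrE// (lt_le_trans u0).
by rewrite /pos_inv ltNge u0.
Qed.

HB.instance Definition _ (R : realType) :=
  isMeasurableFun.Build _ _ _ _ (@pos_inv R) (@measurable_pos_inv R).

(** In this section U = 1/X where X has law [nu]; its distribution function on the
    positive half-line is [G], and its density there is [g]. *)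
Section concave_tail.
Context {R : realType} (nu : probability R R) (F : R -> R).
Notation lebesgue := (@lebesgue_measure R).
Hypothesis nuF : forall x, nu `]-oo, x]%classic = (F x)%:E.
Let G (u : R) : R := 1 - F u^-1.
Hypothesis G_slope : forall w u v : R, 0 < w -> w < u -> u < v ->
  (G v - G u) / (v - u) <= (G u - G w) / (u - w).

Let F_nd u v : u <= v -> F u <= F v.
Proof.
move=> uv; rewrite -lee_fin -!nuF le_measure ?inE//.
exact: subitvPr.
Qed.

Let nu_tail x : nu `]x, +oo[%classic = (1 - F x)%:E.
Proof.
by rewrite -setCitvl probability_setC// nuF.
Qed.

Let G_nd u v : 0 < u -> u <= v -> G u <= G v.
Proof.
move=> u0 uv; rewrite /G lerD2l lerN2 F_nd// lef_pV2// posrE//.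
exact: lt_le_trans uv.
Qed.

Let g := left_slope G.

(** The tail of a probability vanishes at infinity, which is 0 for U. *)
Lemma tail_near0 (y : R) : 0 < y -> G (y / n.+1%:R) @[n --> \oo] --> (0 : R).
Proof.
move=> y0.
suff H : (G (y / n.+1%:R))%:E @[n --> \oo] --> (0%:E : \bar R).
  exact: (fine_cvg H).
have : nu (`]n.+1%:R / y, +oo[%classic : set R) @[n --> \oo] -->
    nu (\bigcap_n (`]n.+1%:R / y, +oo[%classic : set R)).
  apply: nonincreasing_cvg_mu => //=.
  - by rewrite (le_lt_trans (probability_le1 _ _)) ?ltry.
  - by apply: bigcap_measurable => // n _; exact: measurable_itv.
  - move=> m n mn; apply/subsetPset; apply: subset_itvr.
    by rewrite bnd_simp ler_pM2r ?invr_gt0// ler_nat.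
rewrite [X in nu X](_ : _ = set0) ?measure0; last first.
  rewrite -subset0 => x /(_ (Num.truncn (x * y)) I) /=.
  rewrite in_itv/= andbT ltr_pdivrMr// => /lt_trans/(_ (truncnS_gt _)).
  by rewrite ltxx.
apply: cvg_trans; apply: near_eq_cvg; near=> n => /=.
by rewrite nu_tail /G invf_div.
Unshelve. all: by end_near. Qed.

Lemma integral_left_slope (y : R) : 0 < y ->
  (\int[lebesgue]_(u in `]0%R, y]) (g u)%:E = (G y)%:E)%E.
Proof.
move=> y0; pose I n : set R := `]y / n.+1%:R, y]%classic.
have mg : measurable_fun [set: R] g by exact: measurable_left_slope.
have UI : \bigcup_n I n = `]0, y]%classic.
  apply/seteqP; split=> [x [n _]|x]; rewrite /I /= !in_itv/=.
    move=> /andP[yx ->]; rewrite andbT; apply: lt_trans yx.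
    by rewrite divr_gt0.
  move=> /andP[x0 xy]; exists (Num.truncn (y / x)) => //=.
  by rewrite in_itv/= xy andbT ltr_pdivrMr// mulrC -ltr_pdivrMr// truncnS_gt.
have : (\int[lebesgue]_(u in I n) (g u)%:E)%E @[n --> \oo] -->
    (\int[lebesgue]_(u in `]0%R, y]) (g u)%:E)%E.
  rewrite -UI; apply: ge0_nondecreasing_set_cvg_integral.
  - move=> m n mn; apply/subsetPset; apply: subset_itvr.
    by rewrite bnd_simp ler_pM2l// lef_pV2 ?posrE// ler_nat.
  - by move=> n; exact: measurable_itv.
  - by move=> n; apply/measurable_funTS/measurable_EFinP.
  - by move=> n x _; rewrite lee_fin; exact: (left_slope_ge0 G_nd).
have In n : (\int[lebesgue]_(u in I n) (g u)%:E)%E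
    = (G y - G (y / n.+1%:R))%:E.
  apply: integral_nonincreasing_slope => //.
  - by move=> u; exact: (left_slope_ge0 G_nd).
  - by move=> u v; exact: left_slope_ni.
  - by move=> u v; exact: left_slope_le.
  - by move=> u v; exact: left_slope_ge.
  - by rewrite divr_gt0.
  - by rewrite ler_pdivrMr// ler_pMr// ler1n.
under eq_fun do rewrite In.
move=> /cvg_unique; apply => //; apply/cvg_EFin; first by near=> n.
rewrite -[X in _ --> X]subr0; apply: cvgB; first exact: cvg_cst.
exact: tail_near0.
Unshelve. all: by end_near. Qed.

Let mg : measurable_fun [set: R] g.
Proof. exact: measurable_left_slope. Qed.

Let g_ge0 u : 0 <= g u.
Proof. exact: left_slope_ge0. Qed.

Let g_le0 u : u <= 0 -> g u = 0.
Proof. by rewrite /g /left_slope ltNge => ->. Qed.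

(** Projecting the area under the graph of [g] realizes the law of U, and slicing
    the same area horizontally gives the mixture of uniform laws. Points outside
    the graph are sent to 0, away from the positive half-line. *)
Let under_graph : set (R * R) := [set z | 0 < z.2 < g z.1].

Let under_graph_proj (z : R * R) : R := if 0 < z.2 < g z.1 then z.1 else 0.

Let m_under_graph_bool :
  measurable_fun [set: R * R] (fun z : R * R => 0 < z.2 < g z.1).
Proof.
apply: measurable_and; apply: measurable_fun_ltr => //.
exact: measurableT_comp.
Qed.

Let measurable_under_graph : measurable under_graph.
Proof.
rewrite (_ : under_graph = [set: R * R] `&`
  (fun z : R * R => 0 < z.2 < g z.1) @^-1` [set true]); last first.
  by rewrite setTI.
exact: m_under_graph_bool.
Qed.

Let measurable_proj : measurable_fun [set: R * R] under_graph_proj.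
Proof. exact: measurable_fun_ifT. Qed.

HB.instance Definition _ :=
  isMeasurableFun.Build _ _ _ _ under_graph_proj measurable_proj.

Let Rpos : set R := `]0, +oo[%classic.
Let mRpos : measurable Rpos.
Proof. exact: measurable_itv. Qed.

Let nu_inv := pushforward nu (@pos_inv R).
Let area_proj := pushforward (lebesgue \x lebesgue)%E under_graph_proj.

Let area_projE (y : R) : 0 < y -> area_proj (`]0, y[%classic : set R) = (G y)%:E.
Proof.
move=> y0; rewrite -integral_left_slope// -integral_itv_bndo_bndc; last first.
  exact/measurable_funTS/measurable_EFinP.
rewrite /area_proj /pushforward /product_measure1 [RHS]integral_mkcond/=.
apply: eq_integral => u _ /=; rewrite patchE mem_setE /= in_itv/=.
transitivity (lebesgue (if 0 < u < y then `]0, g u[%classic : set R else set0)).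
  congr (lebesgue_measure _); apply/seteqP; split=> r; rewrite /xsection/=.
    rewrite inE /preimage/= in_itv/= /under_graph_proj/=.
    by case: ifPn => [rg ->|]; rewrite ?ltxx//= in_itv.
  case: ifPn => // uy; rewrite /= in_itv/= => rg.
  by rewrite inE /preimage/= in_itv/= /under_graph_proj/= rg.
case: ifPn => _; last by rewrite measure0.
by rewrite lebesgue_measure_itv/= lte_fin; case: ltP => gu; rewrite ?sube0//;
  congr EFin; apply/eqP; rewrite eq_le g_ge0 gu.
Qed.

Let nu_invE (y : R) : 0 < y -> nu_inv (`]0, y[%classic : set R) = (G y)%:E.
Proof.
move=> y0; rewrite /nu_inv /pushforward /G -nu_tail; congr (nu _).
apply/seteqP; split=> x /=; rewrite !in_itv/= ?andbT /pos_inv.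
  by case: ifPn => [x0|]; rewrite ?ltxx// invr_gt0 x0/= invf_plt ?posrE.
move=> yx; have x0 : 0 < x by rewrite (lt_trans _ yx)// invr_gt0.
by rewrite x0 invr_gt0 x0/= invf_plt ?posrE.
Qed.

(** Two measures that agree on the intervals ]0, y[, where they are finite, agree
    on the positive half-line. *)
Let nu_inv_area (A : set R) : measurable A -> A `<=` Rpos ->
  nu_inv A = area_proj A.
Proof.
move=> mA ARpos; have AE : A = A `&` Rpos by rewrite setIidl.
have eqRpos x : `]-oo, x[%classic `&` Rpos = `]0, x[%classic.
  apply/seteqP; split=> u /=; rewrite /Rpos/= !in_itv/= ?andbT.
    by move=> [-> ->].
  by move=> /andP[].
suff : mrestr nu_inv mRpos A = mrestr area_proj mRpos A by rewrite /mrestr -AE.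
apply: (measure_unique (@RGenInftyO.G R) (fun n => `]-oo, n%:R[%classic)) => //=.
- exact: RGenInftyO.measurableE.
- move=> _ _ [x ->] [y ->]; exists (Num.min x y).
  apply/seteqP; split=> u /=; rewrite !in_itv/= lt_min.
    by move=> [-> ->].
  by move=> /andP[].
- by move=> n; exists n%:R.
- rewrite -subTset => x _; exists (Num.truncn x).+1 => //=.
  by rewrite in_itv/= truncnS_gt.
- move=> _ [x ->]; rewrite /mrestr eqRpos.
  have [x0|x0] := ltP 0 x; first by rewrite [LHS]nu_invE// [RHS]area_projE.
  by rewrite set_itv_ge ?measure0// bnd_simp -leNgt.
- move=> n; rewrite /mrestr eqRpos.
  have [n0|n0] := ltP 0 (n%:R : R); first by rewrite [ltLHS]nu_invE// ltry.
  by rewrite set_itv_ge ?measure0// bnd_simp -leNgt.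
Qed.

Lemma pos_invK (x : R) : 0 < x -> pos_inv (pos_inv x) = x.
Proof. by move=> x0; rewrite /pos_inv x0 invr_gt0 x0 invrK. Qed.

(** The density [g] is the integral over r of the indicator of [r < g u]. *)
Lemma layer_cake (m : R -> \bar R) : measurable_fun [set: R] m ->
  (forall x, 0 <= m x)%E ->
  (\int[nu]_(x in Rpos) m x =
   \int[lebesgue]_(r in Rpos)
     \int[lebesgue]_(u in [set u | (r < g u)%R]) m (pos_inv u))%E.
Proof.
move=> mm m0.
pose f : R -> \bar R := m \o pos_inv.
have mf : measurable_fun [set: R] f.
  by apply: measurableT_comp mm _; exact: measurable_pos_inv.
have f0 u : (0 <= f u)%E by exact: m0.
transitivity (\int[nu]_(x in @pos_inv R @^-1` Rpos) (f \o pos_inv) x)%E.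
  rewrite (_ : pos_inv @^-1` Rpos = Rpos); last first.
    apply/seteqP; split=> x /=; rewrite /Rpos/= !in_itv/= !andbT /pos_inv.
      by case: ifPn; rewrite ?ltxx.
    by move=> x0; rewrite x0 invr_gt0.
  apply: eq_integral => x; rewrite inE /Rpos/= in_itv/= andbT => x0.
  by rewrite /f /= pos_invK.
rewrite -ge0_integral_pushforward//; last exact: measurable_funTS.
rewrite -/nu_inv (eq_measure_integral area_proj); last first.
  exact: nu_inv_area.
rewrite /area_proj ge0_integral_pushforward//; last exact: measurable_funTS.
rewrite (_ : under_graph_proj @^-1` Rpos = under_graph); last first.
  apply/seteqP; split=> z /=; rewrite /Rpos/under_graph/= in_itv/= andbT.
    by rewrite /under_graph_proj; case: ifPn => //; rewrite ltxx.
  rewrite /under_graph_proj => /[dup] h ->; rewrite ltNge; apply/negP => z0.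
  by move: h; rewrite g_le0// => /andP[/lt_trans/[apply]]; rewrite ltxx.
rewrite integral_mkcond.
have mfp : measurable_fun [set: R * R] ((f \o under_graph_proj) \_ under_graph).
  apply/(measurable_restrictT _ measurable_under_graph)/measurable_funTS.
  exact: measurableT_comp mf _.
rewrite fubini_tonelli2//; last first.
  by move=> z; apply: erestrict_ge0 => x _; exact: f0.
rewrite [RHS]integral_mkcond; apply: eq_integral => r _.
rewrite patchE mem_setE/= in_itv/= andbT /fubini_G.
case: ifPn => r0; last first.
  apply: integral0_eq => u _; rewrite patchE; case: ifPn => //.
  by rewrite inE /under_graph/= (negbTE r0).
rewrite [RHS]integral_mkcond; apply: eq_integral => u _; rewrite !patchE.
have -> : ((u, r) \in under_graph) = (u \in [set u | r < g u]).
  by apply/idP/idP; rewrite !inE /under_graph/= r0.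
by case: ifPn => //; rewrite inE /= /under_graph_proj/= r0 => ->.
Qed.

(** As [g] is nonincreasing, a superlevel set is an interval starting at 0. It is
    bounded because u g(u) / 2 <= G u - G (u / 2) <= 1. *)
Lemma superlevel_integral (r : R) : 0 < r ->
  exists a : R, forall f : R -> \bar R, measurable_fun [set: R] f ->
    (\int[lebesgue]_(u in [set u | (r < g u)%R]) f u =
     \int[lebesgue]_(u in `]0%R, a[) f u)%E.
Proof.
move=> r0; set A := [set u | _].
have Apos u : A u -> 0 < u.
  rewrite /A/= => rg; rewrite ltNge; apply/negP => u0.
  by move: rg; rewrite g_le0// ltNge ltW.
have Adown u v : A u -> 0 < v -> v <= u -> A v.
  move=> Au v0 vu; rewrite /A/= (lt_le_trans Au)//.
  exact: (left_slope_ni G_slope G_nd).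
have Abound u : A u -> u <= 2 / r.
  move=> Au; have u0 := Apos _ Au.
  rewrite ler_pdivlMr//.
  have u2 : 0 < u / 2 by rewrite divr_gt0.
  have u2u : u / 2 <= u by rewrite ler_pdivrMr// ler_pMr// ler1n.
  have := left_slope_le G_nd u2 u2u; rewrite -/g => gu.
  have G1 : G u - G (u / 2) <= 1.
    rewrite /G; have : F (u / 2)^-1 <= 1.
      by rewrite -lee_fin -nuF probability_le1.
    have : 0 <= F u^-1 by rewrite -lee_fin -nuF.
    lra.
  move: Au; rewrite /A/= => Au; nra.
have [A0|/set0P[u1 Au1]] := eqVneq A set0.
  exists 0 => f _; rewrite A0 integral_set0 set_itv_ge ?integral_set0//.
  by rewrite bnd_simp ltxx.
have supA : has_sup A.
  by split; [exists u1|exists (2 / r) => u; exact: Abound].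
exists (sup A) => f mf.
have Asub u : A u -> u <= sup A by move=> Au; exact: ub_le_sup supA.2 _ Au.
have subA u : 0 < u -> u < sup A -> A u.
  move=> u0; rewrite -subr_gt0 => uA; have [v Av uv] := sup_adherent uA supA.
  by apply: (Adown v) => //; rewrite ltW//; move: uv; rewrite subKr.
have [AsA|NAsA] := pselect (A (sup A)).
  rewrite integral_itv_bndo_bndc; last exact: measurable_funTS.
  congr (integral _ _ _); apply/seteqP; split=> u; rewrite /= in_itv/=.
    by move=> Au; rewrite Apos// Asub.
  by move=> /andP[u0]; rewrite le_eqVlt => /predU1P[->//|/subA]; exact.
congr (integral _ _ _); apply/seteqP; split=> u; rewrite /= in_itv/=.
  move=> Au; rewrite Apos//= lt_neqAle Asub// andbT.
  by apply/eqP => uA; apply: NAsA; rewrite -uA.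
by move=> /andP[u0 /subA]; exact.
Qed.

Hypothesis nu_neg : nu `]-oo, 0[%classic = 0%E.

(** The law of X is a mixture of a mass at 0 and of laws of 1/U with U uniform on
    some ]0, a[: testing the inequality on these extreme laws is enough. *)
Lemma inverted_concave_le_integral (m1 m2 : R -> \bar R) :
  measurable_fun [set: R] m1 -> measurable_fun [set: R] m2 ->
  (forall x, 0 <= m1 x)%E -> (forall x, 0 <= m2 x)%E ->
  (m1 0%R <= m2 0%R)%E ->
  (forall a : R, \int[lebesgue]_(u in `]0%R, a[) m1 (pos_inv u) <=
            \int[lebesgue]_(u in `]0%R, a[) m2 (pos_inv u))%E ->
  (\int[nu]_x m1 x <= \int[nu]_x m2 x)%E.
Proof.
move=> mm1 mm2 m10 m20 m12_0 m12.
have split_integral (m : R -> \bar R) : measurable_fun [set: R] m ->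
    (forall x, 0 <= m x)%E ->
    (\int[nu]_x m x = \int[nu]_(x in [set 0%R]) m x + \int[nu]_(x in Rpos) m x)%E.
  move=> mm m0.
  have -> : [set: R] = `]-oo, 0[%classic `|` ([set 0] `|` Rpos).
    apply/esym; rewrite -subTset => x _ /=; rewrite /Rpos/= !in_itv/= andbT.
    by case: ltgtP => [_|_|->]; [left|right; right|right; left].
  rewrite ge0_integral_setU//=; last 3 first.
  - exact: measurableU.
  - exact: measurable_funTS.
  - apply/disj_setPRL => x /=; rewrite /Rpos/= !in_itv/= andbT.
    by case=> [->|/ltW]; rewrite ?ltxx// leNgt => /negP.
  rewrite null_set_integral ?add0e//; last exact: measurable_funTS.
  rewrite ge0_integral_setU//=; first exact: measurable_funTS.
  apply/disj_setPRL => x /=; rewrite /Rpos/= in_itv/= andbT => x0 /eqP.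
  by rewrite gt_eqF.
rewrite !split_integral//; apply: leeD.
  apply: ge0_le_integral => //; [exact: measurable_funTS..|].
  by move=> x ->.
rewrite !layer_cake//.
have mlevel (m : R -> \bar R) : measurable_fun [set: R] m ->
    measurable_fun [set: R] (m \o pos_inv).
  by move=> mm; apply: measurableT_comp mm _; exact: measurable_pos_inv.
have mcake (m : R -> \bar R) : measurable_fun [set: R] m ->
    (forall x, 0 <= m x)%E -> measurable_fun Rpos (fun r =>
     \int[lebesgue]_(u in [set u | (r < g u)%R]) m (pos_inv u))%E.
  move=> mm m0.
  pose h : R * R -> \bar R := (fun z => m (pos_inv z.1)) \_ under_graph.
  have mh : measurable_fun [set: R * R] h.
    apply/(measurable_restrictT _ measurable_under_graph)/measurable_funTS.
    exact: (measurableT_comp (mlevel _ mm)).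
  have h0 z : (0 <= h z)%E by apply: erestrict_ge0 => x _; exact: m0.
  apply: (@eq_measurable_fun _ _ _ _ _ (fubini_G lebesgue h)); last first.
    by apply: measurable_funTS; exact: measurable_fun_fubini_tonelli_G.
  move=> r; rewrite inE /Rpos/= in_itv/= andbT /fubini_G => r0.
  rewrite [RHS]integral_mkcond; apply: eq_integral => u _.
  rewrite /h !patchE.
  suff -> : ((u, r) \in under_graph) = (u \in [set u | r < g u]) by [].
  by apply/idP/idP; rewrite !inE /under_graph/= r0.
apply: ge0_le_integral => //; [|exact: mcake..|].
  by move=> r _; exact: integral_ge0.
move=> r; rewrite /Rpos/= in_itv/= andbT => r0.
have [a la] := superlevel_integral r0.
rewrite (la _ (mlevel _ mm1)) (la _ (mlevel _ mm2)); exact: m12.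
Qed.

(** The extreme-law principle applied in x and then, after exchanging the
    integrals, in y. *)
Lemma inverted_concave_le_integral2 (K1 K2 : R * R -> \bar R) :
  measurable_fun [set: R * R] K1 -> measurable_fun [set: R * R] K2 ->
  (forall z, 0 <= K1 z)%E -> (forall z, 0 <= K2 z)%E ->
  (K1 (0%R, 0%R) <= K2 (0%R, 0%R))%E ->
  (forall a : R, \int[lebesgue]_(u in `]0%R, a[) K1 (pos_inv u, 0%R) <=
                 \int[lebesgue]_(u in `]0%R, a[) K2 (pos_inv u, 0%R))%E ->
  (forall b : R, \int[lebesgue]_(v in `]0%R, b[) K1 (0%R, pos_inv v) <=
                 \int[lebesgue]_(v in `]0%R, b[) K2 (0%R, pos_inv v))%E ->
  (forall a b : R,
    \int[lebesgue]_(v in `]0%R, b[)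
      \int[lebesgue]_(u in `]0%R, a[) K1 (pos_inv u, pos_inv v) <=
    \int[lebesgue]_(v in `]0%R, b[)
      \int[lebesgue]_(u in `]0%R, a[) K2 (pos_inv u, pos_inv v))%E ->
  (\int[nu]_x \int[nu]_y K1 (x, y) <= \int[nu]_x \int[nu]_y K2 (x, y))%E.
Proof.
move=> mK1 mK2 K10 K20 K00 Ka Kb Kab.
have mpair (K : R * R -> \bar R) : measurable_fun [set: R * R] K ->
    measurable_fun [set: R * R] (fun z => K (pos_inv z.1, z.2)).
  move=> mK; apply: (measurableT_comp mK); apply: measurable_fun_pair => //.
  exact: (measurableT_comp (@measurable_pos_inv R)).
have msec (K : R * R -> \bar R) x : measurable_fun [set: R * R] K ->
    measurable_fun [set: R] (fun y => K (x, y)).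
  by move=> mK; apply: (measurableT_comp mK); exact: measurable_pair1.
have mint (K : R * R -> \bar R) : measurable_fun [set: R * R] K ->
    (forall z, 0 <= K z)%E -> measurable_fun [set: R] (fun x => \int[nu]_y K (x, y))%E.
  by move=> mK K0; exact: measurable_fun_fubini_tonelli_F.
apply: inverted_concave_le_integral => //; [exact: mint|exact: mint|..].
- by move=> x; exact: integral_ge0.
- by move=> x; exact: integral_ge0.
- by apply: inverted_concave_le_integral => //; exact: msec.
- move=> a.
  have swap (K : R * R -> \bar R) (mK : measurable_fun [set: R * R] K)
      (K0 : forall z, (0 <= K z)%E) :=
    @fubini_tonelli_in _ _ _ _ R lebesgue nu `]0, a[%classic
      (fun z => K (pos_inv z.1, z.2)) (measurable_itv _) (mpair _ mK) (fun z => K0 _).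
  have [m1 ->] := swap _ mK1 K10; have [m2 ->] := swap _ mK2 K20.
  apply: inverted_concave_le_integral => //= x; exact: integral_ge0.
Qed.

End concave_tail.

(** * Area of a rectangle above a hyperbola *)

Section hyperbola_area.
Context {R : realType}.
Notation lebesgue := (@lebesgue_measure R).
Implicit Types a b c p q s u v x y : R.

Lemma integral_hyperbola (al s q v0 b : R) : q < v0 -> v0 <= b ->
  (\int[lebesgue]_(v in `]v0, b[) (al - s / (v - q))%:E =
   (al * (b - v0) - s * (ln (b - q) - ln (v0 - q)))%:E)%E.
Proof.
move=> qv0; rewrite le_eqVlt => /predU1P[<-|v0b].
  by rewrite set_itv_ge ?bnd_simp ?ltxx// integral_set0 !subrr !mulr0 subrr.
pose f (v : R) := al - s / (v - q).
pose Phi (v : R) := al * v - s * ln (v - q).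
have dPhi v : v0 <= v -> is_derive v 1 Phi (f v).
  move=> v0v; have vq : 0 < v - q by rewrite subr_gt0 (lt_le_trans qv0).
  have dln : is_derive v 1 (fun t : R => ln (t - q)) (v - q)^-1.
    have dl := is_derive1_ln vq.
    by apply: is_derive_eq; rewrite subr0 mulr1.
  rewrite /Phi /f; apply: is_derive_eq.
  by rewrite /GRing.scale/= mulr1.
have cPhi v : v0 <= v -> {for v, continuous Phi}.
  by move=> /dPhi dv; apply/differentiable_continuous/derivable1_diffP; case: dv.
have cf v : v0 <= v -> {for v, continuous f}.
  move=> v0v; have vq : v - q != 0.
    by rewrite subr_eq0 gt_eqF// (lt_le_trans qv0).
  apply: cvgB; first exact: cvg_cst.
  apply: cvgM; first exact: cvg_cst.
  by apply: cvgV => //; apply: cvgB; [exact: cvg_id|exact: cvg_cst].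
have mf : measurable_fun `]v0, b[ f.
  apply: open_continuous_measurable_fun; first exact: interval_open.
  by move=> v; rewrite inE/= in_itv/= => /andP[/ltW/cf].
transitivity (\int[lebesgue]_(v in `[v0, b]) (f v)%:E)%E.
  by rewrite [RHS]integral_itv_bndoo//; exact/measurable_EFinP.
rewrite (@continuous_FTC2 _ f Phi)//.
- by rewrite -EFinB; congr EFin; rewrite /Phi; ring.
- apply: continuous_in_subspaceT => v.
  by rewrite inE/= in_itv/= => /andP[/cf].
- split.
  + by move=> v; rewrite in_itv/= => /andP[/ltW/dPhi[]].
  + by apply: cvg_at_right_filter; apply: cPhi.
  + by apply: cvg_at_left_filter; apply: cPhi; exact: ltW.
- by move=> v; rewrite in_itv/= derive1E => /andP[/ltW/dPhi[]].
Qed.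

(** Area of the part of ]0, a[ x ]0, b[ above the branch (u - p)(v - q) = p q,
    u > p, v > q. With A = (a - p)(b - q)/(p q) it reads p q (A - 1 - ln A). The
    logarithms are kept apart so that the formula still holds when p q = 0, where
    their factor vanishes. *)
Definition corner_area p q a b : R :=
  if [&& p <= a, q <= b & p * q <= (a - p) * (b - q)]
  then (a - p) * (b - q) - p * q
       - p * q * (ln ((a - p) * (b - q)) - ln (p * q))
  else 0.

Lemma integral_tail_indic (w a : R) : 0 <= w ->
  (\int[lebesgue]_(u in `]0%R, a[) ((w <= u)%R%:R)%:E = (Num.max 0 (a - w))%:E)%E.
Proof.
move=> w0; have mw : measurable_fun [set: R] (fun u : R => ((w <= u)%R%:R : R)%:E).
  have -> : (fun u : R => ((w <= u)%R%:R : R)%:E) =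
      EFin \o \1_(`[w, +oo[%classic : set R).
    apply/funext => u /=; rewrite indicE; congr ((_%:R)%:E).
    by rewrite mem_setE/= in_itv/= andbT.
  by apply/measurable_EFinP; exact: measurable_indic.
have [aw|wa] := leP a w.
  rewrite max_l ?subr_le0//; apply: integral0_eq => u.
  by rewrite /= in_itv/= => /andP[_ ua]; rewrite leNgt (lt_le_trans ua).
rewrite max_r ?subr_ge0 1?ltW//.
rewrite (@itv_bndbnd_setU _ _ _ (BRight w)) ?bnd_simp//.
rewrite ge0_integral_setU//=; last 2 first.
- exact: measurable_funTS.
- apply/disj_setPRL => u /=; rewrite !in_itv/= => /andP[wu _] /andP[_].
  by rewrite leNgt wu.
rewrite -integral_itv_bndo_bndc; last exact: measurable_funTS.
rewrite integral0_eq ?add0e; last first.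
  by move=> u; rewrite /= in_itv/= => /andP[_]; rewrite ltNge => /negbTE ->.
transitivity (\int[lebesgue]_(u in `]w, a[) 1%:E)%E.
  by apply: eq_integral => u; rewrite inE/= in_itv/= => /andP[/ltW ->].
by rewrite integral_cst//= mul1e lebesgue_measure_itv/= lte_fin wa.
Qed.

(** An indicator, valued in the extended reals to be integrated directly. *)
Definition halfplane p q c (z : R * R) : \bar R :=
  ((p * z.1 + q * z.2 <= c)%R%:R : R)%:E.

Lemma halfplane_ge0 p q c z : (0 <= halfplane p q c z)%E.
Proof. by rewrite lee_fin. Qed.

Lemma measurable_halfplane p q c : measurable_fun [set: R * R] (halfplane p q c).
Proof.
apply/measurable_EFinP.
have mb : measurable_fun [set: R * R] (fun z : R * R => p * z.1 + q * z.2 <= c).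
  apply: measurable_fun_ler => //.
  by apply: measurable_funD; exact: measurable_funM.
rewrite (_ : (fun _ => _) =
  fun z : R * R => if p * z.1 + q * z.2 <= c then 1 else 0); last first.
  by apply/funext => z; case: ifP.
exact: measurable_fun_ifT.
Qed.

Lemma measurable_halfplane_slice p q a :
  measurable_fun [set: R] (fun v =>
    \int[lebesgue]_(u in `]0%R, a[) halfplane p q 1 (pos_inv u, pos_inv v))%E.
Proof.
apply: (@fubini_tonelli_in _ _ _ _ R lebesgue lebesgue `]0, a[%classic
  (fun z => halfplane p q 1 (pos_inv z.1, pos_inv z.2)) _ _
  (fun z => halfplane_ge0 _ _ _ _)).1 => //.
apply: (measurableT_comp (measurable_halfplane p q 1)).
by apply: measurable_fun_pair; exact: (measurableT_comp (@measurable_pos_inv R)).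
Qed.

Lemma measurable_halfplane_line p q v :
  measurable_fun [set: R] (fun u => halfplane p q 1 (pos_inv u, v)).
Proof.
apply: (measurableT_comp (measurable_halfplane p q 1)).
by apply: measurable_fun_pair => //; exact: measurable_pos_inv.
Qed.

(** For v > q the condition p/u + q/v <= 1 reads u >= p + p q / (v - q); for
    v < q no u > 0 satisfies it. The line v = q is excluded because its slice
    depends on whether p = 0. *)
Lemma halfplane_slice p q a v : 0 <= p -> 0 <= q -> 0 < v -> v != q ->
  (\int[lebesgue]_(u in `]0%R, a[) halfplane p q 1 (pos_inv u, pos_inv v) =
   (if q < v then Num.max 0 (a - p - p * q / (v - q)) else 0)%:E)%E.
Proof.
move=> p0 q0 v0 vq; case: ifPn => [qv|]; last first.
  rewrite -leNgt le_eqVlt (negbTE vq)/= => qv.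
  apply: integral0_eq => u; rewrite /= in_itv/= => /andP[u0 _].
  rewrite /halfplane/= /pos_inv u0 v0 leNgt.
  rewrite (lt_le_trans (y := q / v)) ?ltr_pdivlMr ?mul1r//.
  by rewrite lerDr mulr_ge0 ?invr_ge0// ltW.
have vq0 : 0 < v - q by rewrite subr_gt0.
pose w := p + p * q / (v - q).
have w0 : 0 <= w by rewrite addr_ge0// mulr_ge0 ?mulr_ge0// invr_ge0 ltW.
rewrite -addrA -opprD -/w -integral_tail_indic//.
apply: eq_integral => u; rewrite inE/= in_itv/= => /andP[u0 _].
rewrite /halfplane/= /pos_inv u0 v0; congr ((_ : bool)%:R%:E).
have wE : w * (v - q) = p * v by rewrite mulrDl divfK ?gt_eqF//; ring.
have uv0 : 0 < u * v by exact: mulr_gt0.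
rewrite -(ler_pM2r uv0) -[in RHS](ler_pM2r vq0) wE.
have -> : (p / u + q / v) * (u * v) = p * v + q * u.
  by field; rewrite !gt_eqF.
by rewrite mul1r mulrBr lerBrDr [u * q]mulrC.
Qed.

(** The contribution of the mass of Y at 0. *)
Lemma halfplane_axis_slice p q a : 0 <= p ->
  (\int[lebesgue]_(u in `]0%R, a[) halfplane p q 1 (pos_inv u, 0%R) =
   (Num.max 0 (a - p))%:E)%E.
Proof.
move=> p0; rewrite -integral_tail_indic//; apply: eq_integral => u.
rewrite inE/= in_itv/= => /andP[u0 _].
by rewrite /halfplane/= mulr0 addr0 /pos_inv u0 ler_pdivrMr// mul1r.
Qed.

Lemma halfplane_area p q a b : 0 <= p -> 0 <= q ->
  (\int[lebesgue]_(v in `]0%R, b[)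
     \int[lebesgue]_(u in `]0%R, a[) halfplane p q 1 (pos_inv u, pos_inv v) =
   (corner_area p q a b)%:E)%E.
Proof.
move=> p0 q0.
pose I v := (\int[lebesgue]_(u in `]0%R, a[) halfplane p q 1 (pos_inv u, pos_inv v))%E.
have I0 v : (0 <= I v)%E by apply: integral_ge0 => u _; exact: halfplane_ge0.
have mI : measurable_fun [set: R] I by exact: measurable_halfplane_slice.
pose f v := Num.max 0 (a - p - p * q / (v - q)).
have If v : q < v -> I v = (f v)%:E.
  by move=> qv; rewrite /I halfplane_slice ?qv// ?gt_eqF// (le_lt_trans q0).
have [bq|qb] := leP b q.
  rewrite (_ : corner_area p q a b = 0); last first.
    rewrite /corner_area; case: ifPn => // /and3P[_ qb].
    have -> : b = q by apply/eqP; rewrite eq_le bq qb.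
    rewrite subrr mulr0 => pq_le0.
    have -> : p * q = 0 by apply/eqP; rewrite eq_le pq_le0 mulr_ge0.
    by rewrite mul0r !subr0.
  apply: integral0_eq => v; rewrite /= in_itv/= => /andP[v0 vb].
  have vq := lt_le_trans vb bq.
  by rewrite halfplane_slice ?lt_eqF// ltNge ltW.
rewrite -/I.
have -> : (\int[lebesgue]_(v in `]0%R, b[) I v = \int[lebesgue]_(v in `]q, b[) I v)%E.
  rewrite (@itv_bndbnd_setU _ _ _ (BRight q)) ?bnd_simp//.
  rewrite ge0_integral_setU//=; last 2 first.
  - exact: measurable_funTS.
  - apply/disj_setPRL => u /=; rewrite !in_itv/= => /andP[wu _] /andP[_].
    by rewrite leNgt wu.
  rewrite -integral_itv_bndo_bndc; last exact: measurable_funTS.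
  rewrite integral0_eq ?add0e// => v; rewrite /= in_itv/= => /andP[v0 vq].
  by rewrite /I halfplane_slice ?lt_eqF// ltNge ltW.
transitivity (\int[lebesgue]_(v in `]q, b[) (f v)%:E)%E.
  by apply: eq_integral => v; rewrite inE/= in_itv/= => /andP[/If ->].
have s0 : 0 <= p * q by rewrite mulr_ge0.
have f_eq0 v : q < v -> (a - p) * (v - q) <= p * q -> f v = 0.
  move=> qv h; rewrite /f max_l// subr_le0 ler_pdivlMr// subr_gt0//.
have [ap|pa] := leP a p.
  rewrite (_ : corner_area p q a b = 0); last first.
    rewrite /corner_area; case: ifPn => // /and3P[pa _].
    have -> : a = p by apply/eqP; rewrite eq_le ap pa.
    rewrite subrr mul0r => pq_le0.
    have -> : p * q = 0 by apply/eqP; rewrite eq_le pq_le0.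
    by rewrite mul0r !subr0.
  apply: integral0_eq => v; rewrite /= in_itv/= => /andP[qv _]; rewrite f_eq0//.
  by rewrite (le_trans _ s0)// mulr_le0_ge0 ?subr_le0 ?subr_ge0// ltW.
have al0 : 0 < a - p by rewrite subr_gt0.
have be0 : 0 < b - q by rewrite subr_gt0.
rewrite /corner_area (ltW pa) (ltW qb)/=.
have [s_eq0|s_neq0] := eqVneq (p * q) 0.
  rewrite s_eq0 mulr_ge0 ?ltW// mul0r !subr0.
  transitivity (\int[lebesgue]_(v in `]q, b[) (a - p)%:E)%E.
    apply: eq_integral => v _.
    by rewrite /f s_eq0 mul0r subr0 max_r// ltW.
  by rewrite integral_cst//= lebesgue_measure_itv/= lte_fin qb.
have {}s0 : 0 < p * q by rewrite lt_neqAle eq_sym s_neq0.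
(* above v0 the hyperbola stays inside u < a *)
pose v0 := q + p * q / (a - p).
have qv0 : q < v0 by rewrite ltrDl divr_gt0.
have v0E : (a - p) * (v0 - q) = p * q.
  by rewrite /v0 addrAC subrr add0r mulrC divfK ?gt_eqF.
have [bv0|v0b] := leP b v0.
  rewrite (_ : (if _ then _ else _) = 0); last first.
    case: ifPn => // sab.
    have <- : p * q = (a - p) * (b - q).
      by apply/eqP; rewrite eq_le sab/= -v0E ler_pM2l// lerD2r.
    by rewrite !subrr mulr0 subr0.
  apply: integral0_eq => v; rewrite /= in_itv/= => /andP[qv vb]; rewrite f_eq0//.
  by rewrite -v0E ler_pM2l// lerD2r (le_trans (ltW vb)).
rewrite -{1}v0E ler_pM2l// lerD2r (ltW v0b).
have mf (D : set R) : measurable D -> (forall v, D v -> q < v) ->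
    measurable_fun D (fun v => (f v)%:E).
  move=> mD Dq; apply: (@eq_measurable_fun _ _ _ _ _ I).
    by move=> v; rewrite inE => /Dq; exact: If.
  exact: measurable_funTS.
rewrite (@itv_bndbnd_setU _ _ _ (BRight v0)) ?bnd_simp ?(ltW qv0)//.
rewrite ge0_integral_setU//=; last 3 first.
- apply: mf; first exact: measurableU.
  by move=> v /=; rewrite !in_itv/= => -[/andP[]//|/andP[/(lt_trans qv0)]].
- by move=> v _; rewrite lee_fin le_max lexx.
- apply/disj_setPRL => u /=; rewrite !in_itv/= => /andP[wu _] /andP[_].
  by rewrite leNgt wu.
rewrite integral0_eq ?add0e; last first.
  move=> v; rewrite /= in_itv/= => /andP[qv vv0]; rewrite f_eq0//.
  by rewrite -v0E ler_pM2l// lerD2r.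
transitivity (\int[lebesgue]_(v in `]v0, b[) (a - p - p * q / (v - q))%:E)%E.
  apply: eq_integral => v; rewrite inE/= in_itv/= => /andP[v0v _].
  rewrite /f max_r// subr_ge0 ler_pdivrMr ?subr_gt0 ?(lt_trans qv0)//.
  by rewrite -v0E ler_pM2l// lerD2r ltW.
rewrite integral_hyperbola ?(ltW v0b)//; congr EFin.
have -> : v0 - q = p * q / (a - p) by rewrite /v0 addrAC subrr add0r.
rewrite ln_div ?posrE// [ln ((a - p) * (b - q))]lnM ?posrE//.
have -> : (a - p) * (b - v0) = (a - p) * (b - q) - p * q.
  by rewrite -v0E; ring.
ring.
Qed.

End hyperbola_area.

(** * The area under spreading of the weights *)

Section corner_area_spread.
Context {R : realType}.
Implicit Types a b c p q s : R.

(** s (ln (s + c) - ln s) = s ln (1 + c/s) is the perspective of the concave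
    function k |-> ln (1 + k), which vanishes at 0. The tangent of the logarithm
    at w = 1 + c/s', weighted at (s + c)/s and at 1, gives the inequality. For
    s = 0 the left-hand side is 0. *)
Lemma mul_ln_incr s s' c : 0 <= s -> s <= s' -> 0 <= s + c ->
  (0 < s -> 0 < s + c) ->
  s * (ln (s + c) - ln s) <= s' * (ln (s' + c) - ln s').
Proof.
rewrite le_eqVlt => /predU1P[<- s'0|s0 ss'].
  rewrite add0r mul0r => c0 _; rewrite le_eqVlt in s'0.
  case/predU1P : s'0 => [<-|s'0]; first by rewrite mul0r.
  rewrite mulr_ge0 ?(ltW s'0)// subr_ge0 ler_ln ?posrE ?lerDl//.
  by rewrite ltr_wpDr.
move=> _ /(_ s0) sc0.
have s'0 : 0 < s' by exact: lt_le_trans ss'.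
have s'c0 : 0 < s' + c by rewrite (lt_le_trans sc0)// lerD2r.
pose w := (s' + c) / s'; have w0 : 0 < w by rewrite divr_gt0.
have tangent y : 0 < y -> ln y <= ln w + (y / w - 1).
  move=> y0; have yw0 : 0 < y / w by rewrite divr_gt0.
  have := @le_ln1Dx R (y / w - 1); rewrite subrKC ln_div ?posrE// => h.
  by have := h ltac:(lra); lra.
have h1 := tangent _ (divr_gt0 sc0 s0).
have h2 := tangent _ ltr01; rewrite ln1 in h2.
rewrite -!ln_div ?posrE// -/w.
have -> : s' * ln w = s * (ln w + ((s + c) / s / w - 1))
    + (s' - s) * (ln w + (1 / w - 1)).
  by rewrite /w; field; rewrite !gt_eqF.
rewrite -[leLHS]addr0; apply: lerD; first by rewrite ler_pM2l.
by rewrite mulr_ge0// subr_ge0.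
Qed.

(** When both corners are cut, the logarithms regroup as the products
    (a - p)(a - q) and (b - p)(b - q), which depend on the weights only through
    p + q and p q. *)
Lemma corner_areaE p q a b : 0 <= p -> 0 <= q ->
  p <= a -> q <= a -> p <= b -> q <= b ->
  p * q <= (a - p) * (b - q) -> p * q <= (a - q) * (b - p) ->
  corner_area p q a b + corner_area q p a b =
  2 * a * b - (p + q) * (a + b)
  - (p * q * (ln (p * q + (a * a - (p + q) * a)) - ln (p * q))
     + p * q * (ln (p * q + (b * b - (p + q) * b)) - ln (p * q))).
Proof.
move=> p0 q0 pa qa pb qb c1 c2.
rewrite /corner_area pa qa pb qb c1 [q * p]mulrC c2/=.
have [s_eq0|s_neq0] := eqVneq (p * q) 0; first by rewrite !s_eq0 !mul0r; lra.
have s0 : 0 < p * q by rewrite lt_neqAle eq_sym s_neq0 mulr_ge0.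
have pos x y : 0 <= x -> 0 <= y -> p * q <= x * y -> 0 < x /\ 0 < y.
  move=> x0 y0 /(lt_le_trans s0) xy0; rewrite !lt_neqAle x0 y0 !andbT.
  by split; apply/eqP => h; move: xy0; rewrite -h ?mul0r ?mulr0 ltxx.
have [ap bq] : 0 < a - p /\ 0 < b - q by apply: pos; rewrite ?subr_ge0.
have [aq bp] : 0 < a - q /\ 0 < b - p by apply: pos; rewrite ?subr_ge0.
have -> : p * q + (a * a - (p + q) * a) = (a - p) * (a - q) by ring.
have -> : p * q + (b * b - (p + q) * b) = (b - p) * (b - q) by ring.
rewrite [ln ((a - p) * (b - q))]lnM ?posrE// [ln ((a - q) * _)]lnM ?posrE//.
rewrite [ln ((a - p) * _)]lnM ?posrE// [ln ((b - p) * _)]lnM ?posrE//.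
ring.
Qed.

Lemma corner_areaC p q a b : corner_area p q a b = corner_area q p b a.
Proof.
rewrite /corner_area andbCA [q * p]mulrC.
by rewrite ![(b - q) * _]mulrC.
Qed.

(** Here the region itself shrinks: for u < a <= p + q the condition
    p'/u + q'/v <= 1 forces u <= v, and then moving weight from 1/u to 1/v
    decreases the left-hand side. *)
Lemma corner_area_decr p q p' q' a b : 0 <= p -> p <= p' -> 0 <= q' -> 0 <= q ->
  p + q = p' + q' -> a <= p + q ->
  corner_area p' q' a b <= corner_area p q a b.
Proof.
move=> p0 pp' q'0 q0 pq a_pq; have p'0 := le_trans p0 pp'.
rewrite -lee_fin -!halfplane_area//.
apply: ge0_le_integral => //.
- by move=> v _; apply: integral_ge0 => u _; exact: halfplane_ge0.
- by apply: measurable_funTS; exact: measurable_halfplane_slice.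
- by apply: measurable_funTS; exact: measurable_halfplane_slice.
move=> v; rewrite /= in_itv/= => /andP[v0 _].
apply: ge0_le_integral => //.
- by move=> u _; exact: halfplane_ge0.
- by apply: measurable_funTS; exact: measurable_halfplane_line.
- by apply: measurable_funTS; exact: measurable_halfplane_line.
move=> u; rewrite /= in_itv/= => /andP[u0 ua].
rewrite /halfplane/= /pos_inv u0 v0 lee_fin ler_nat.
case: (leP (p' / u + q' / v) 1) => // h'.
suff -> : p / u + q / v <= 1 by [].
have uvE (x y : R) : (x / u + y / v <= 1) = (x * v + y * u <= u * v).
  rewrite -(ler_pM2r (mulr_gt0 u0 v0)) mul1r; congr (_ <= _).
  by field; rewrite !gt_eqF.
move: h'; rewrite !uvE => h'.
have [uv|vu] := leP u v; first nra.
have : (p' + q') * v <= u * v by nra.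
rewrite ler_pM2r// -pq => pu.
by move: (lt_le_trans ua a_pq); rewrite ltNge pu.
Qed.

Lemma corner_area_spread p q p' q' a b : 0 <= p -> p <= p' -> p' <= q' ->
  p + q = p' + q' ->
  corner_area p' q' a b + corner_area q' p' a b <=
  corner_area p q a b + corner_area q p a b.
Proof.
move=> p0 pp' pq' pq.
wlog ab : a b / a <= b.
  move=> H; have [/H//|/ltW/H] := leP a b.
  rewrite addrC [leRHS]addrC.
  by rewrite !(corner_areaC _ _ b).
have p'0 := le_trans p0 pp'.
have q'0 := le_trans p'0 pq'.
have qq' : q' <= q by lra.
have q0 := le_trans q'0 qq'.
(* the hyperbola meets the corner of [corner_area y x a b], the smaller one
   since a <= b *)
pose cond (x y : R) := [&& y <= a, x <= b & y * x <= (a - y) * (b - x)].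
(* then it also meets the other corner, and this persists for closer weights *)
have both x y x' y' : 0 <= x -> x <= x' -> x' <= y' -> x + y = x' + y' ->
    cond x y ->
    corner_area x' y' a b + corner_area y' x' a b <=
    corner_area x y a b + corner_area y x a b.
  move=> x0 xx' xy' xy /and3P[ya xb yx].
  have x'0 := le_trans x0 xx'; have y'0 := le_trans x'0 xy'.
  have yy' : y' <= y by lra.
  rewrite !corner_areaE//; try nra.
  rewrite xy lerD2l lerN2; set sg := x' + y'.
  have ss' : x * y <= x' * y' by nra.
  have ya_lt : 0 < x * y -> y < a.
    move=> s0; rewrite lt_neqAle ya andbT; apply/eqP => yaE.
    by move: yx; rewrite yaE subrr mul0r -yaE mulrC leNgt s0.
  apply: lerD; apply: mul_ln_incr => //.
  - by rewrite mulr_ge0//; lra.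
  - rewrite /sg -xy.
    have -> : x * y + (a * a - (x + y) * a) = (a - x) * (a - y) by ring.
    by rewrite mulr_ge0// subr_ge0; lra.
  - rewrite /sg -xy.
    have -> : x * y + (a * a - (x + y) * a) = (a - x) * (a - y) by ring.
    by move=> /ya_lt ya'; rewrite mulr_gt0// subr_gt0; lra.
  - by rewrite mulr_ge0//; lra.
  - rewrite /sg -xy.
    have -> : x * y + (b * b - (x + y) * b) = (b - x) * (b - y) by ring.
    by rewrite mulr_ge0// subr_ge0; lra.
  - rewrite /sg -xy.
    have -> : x * y + (b * b - (x + y) * b) = (b - x) * (b - y) by ring.
    by move=> /ya_lt ya'; rewrite mulr_gt0// subr_gt0; lra.
have [c|nc] := boolP (cond p q); first exact: both.
have a_pq : a <= p + q.
  rewrite leNgt; apply/negP => pqa; move/negP: nc; apply.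
  by apply/and3P; split; [lra|lra|nra].
rewrite [corner_area q p a b](_ : _ = 0) ?addr0; last first.
  by rewrite /corner_area; case: ifP => // c; rewrite /cond c in nc.
have [c'|nc'] := boolP (cond p' q'); last first.
  rewrite [corner_area q' p' a b](_ : _ = 0) ?addr0; last first.
    by rewrite /corner_area; case: ifP => // c; rewrite /cond c in nc'.
  exact: corner_area_decr.
have /and3P[q'a p'b q'p'] := c'.
have b0 : 0 <= b by lra.
have b_gt0 : 0 < b.
  rewrite lt_neqAle eq_sym b0 andbT; apply/eqP => b_eq0; move/negP: nc; apply.
  by apply/and3P; split; [lra|lra|nra].
have {}ab : a < b.
  rewrite lt_neqAle ab andbT; apply/eqP => abE; move/negP: nc; apply.
  have aE : a = p + q by apply/eqP; rewrite eq_le a_pq/=; nra.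
  by apply/and3P; split; [lra|lra|rewrite -abE aE; lra].
have ba : 0 < b - a by lra.
have ncE : a * b <= p * a + q * b.
  rewrite leNgt; apply/negP => h; move/negP: nc; apply.
  have qa : q <= a by nra.
  by apply/and3P; split; [lra|nra|nra].
have c'E : p' * a + q' * b <= a * b by nra.
(* x is the weight at which the smaller region appears: x/b + y/a = 1 *)
pose x := b * (p + q - a) / (b - a).
pose y := a * (b - (p + q)) / (b - a).
have xy : x + y = p + q by rewrite /x /y; field; rewrite subr_eq0 gt_eqF.
have px : p <= x by rewrite ler_pdivlMr//; lra.
have xp' : x <= p' by rewrite ler_pdivrMr//; nra.
have xyE : y * x = (a - y) * (b - x).
  by rewrite /x /y; field; rewrite subr_eq0 gt_eqF.
have ya : y <= a by rewrite ler_pdivrMr//; nra.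
have cxy : cond x y by rewrite /cond ya -xyE lexx (le_trans xp').
have a0 : corner_area y x a b = 0.
  by rewrite /corner_area -xyE; case: ifP => // _; rewrite !subrr mulr0 subrr.
apply: (@le_trans _ _ (corner_area x y a b + corner_area y x a b)).
  apply: both => //; try lra.
rewrite a0 addr0; apply: corner_area_decr => //; lra.
Qed.

End corner_area_spread.

(** * Weighted sums of two independent copies *)

Section weighted_pair.
Context {R : realType} (nu : probability R R) (F : R -> R).
Notation lebesgue := (@lebesgue_measure R).
Hypothesis nuF : forall x, nu `]-oo, x]%classic = (F x)%:E.
Let G (u : R) : R := 1 - F u^-1.
Hypothesis G_slope : forall w u v : R, 0 < w -> w < u -> u < v ->
  (G v - G u) / (v - u) <= (G u - G w) / (u - w).
Hypothesis nu_neg : nu `]-oo, 0[%classic = 0%E.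

(** X is almost surely nonnegative. *)
Let le_integral_nonneg (m1 m2 : R -> \bar R) :
  measurable_fun [set: R] m1 -> measurable_fun [set: R] m2 ->
  (forall x, 0 <= m1 x)%E -> (forall x, 0 <= m2 x)%E ->
  (forall x : R, 0 <= x -> (m1 x <= m2 x)%E) ->
  (\int[nu]_x m1 x <= \int[nu]_x m2 x)%E.
Proof.
move=> mm1 mm2 m10 m20 m12.
apply: (inverted_concave_le_integral nuF) => //; first exact: m12.
move=> a; apply: ge0_le_integral => //.
- by apply: measurable_funTS; apply: measurableT_comp mm1 _; exact: measurable_pos_inv.
- by apply: measurable_funTS; apply: measurableT_comp mm2 _; exact: measurable_pos_inv.
- move=> u _; apply: m12; rewrite /pos_inv; case: ifPn => // u0.
  by rewrite invr_ge0 ltW.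
Qed.

Definition pair_prob (p q c : R) : \bar R :=
  (\int[nu]_x \int[nu]_y halfplane p q c (x, y))%E.

Let mhp p q c : measurable_fun [set: R] (fun x => \int[nu]_y halfplane p q c (x, y))%E.
Proof.
apply: measurable_fun_fubini_tonelli_F; first exact: measurable_halfplane.
exact: halfplane_ge0.
Qed.

Let mhp1 p q c x : measurable_fun [set: R] (fun y => halfplane p q c (x, y)).
Proof.
by apply: (measurableT_comp (measurable_halfplane p q c)); exact: measurable_pair1.
Qed.

(** Exchangeability of X and Y. *)
Lemma pair_probC p q c : pair_prob p q c = pair_prob q p c.
Proof.
rewrite /pair_prob (fubini_tonelli (halfplane p q c)); last 2 first.
- exact: measurable_halfplane.
- exact: halfplane_ge0.
apply: eq_integral => x _; apply: eq_integral => y _.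
by rewrite /halfplane/= addrC.
Qed.

(** Twice the probability is the integral of a kernel symmetric in p and q, to
    which the extreme-law principle applies. *)
Let pair_prob_spread1 p q p' q' : 0 <= p -> p <= p' -> p' <= q' ->
  p + q = p' + q' -> (pair_prob p' q' 1 <= pair_prob p q 1)%E.
Proof.
move=> p0 pp' pq' pq.
have p'0 := le_trans p0 pp'; have q'0 := le_trans p'0 pq'.
have q0 : 0 <= q by lra.
pose S (x y : R) z := (halfplane x y 1 z + halfplane y x 1 z)%E.
have S0 x y z : (0 <= S x y z)%E by rewrite adde_ge0 ?halfplane_ge0.
have mS x y : measurable_fun [set: R * R] (S x y).
  by apply: emeasurable_funD; exact: measurable_halfplane.
have intS x y : (\int[nu]_s \int[nu]_t S x y (s, t) =
    pair_prob x y 1 + pair_prob x y 1)%E.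
  rewrite {2}pair_probC /pair_prob -ge0_integralD//; last 2 first.
  - by move=> s _; apply: integral_ge0 => t _; exact: halfplane_ge0.
  - by move=> s _; apply: integral_ge0 => t _; exact: halfplane_ge0.
  apply: eq_integral => s _; rewrite ge0_integralD//.
  - by move=> t _; exact: halfplane_ge0.
  - by move=> t _; exact: halfplane_ge0.
have axis (x y : R) : 0 <= x -> 0 <= y -> forall a : R,
  (\int[lebesgue]_(u in `]0%R, a[) S x y (pos_inv u, 0%R) =
   (Num.max 0 (a - x) + Num.max 0 (a - y))%:E)%E.
  move=> x0 y0 a; rewrite ge0_integralD//=.
  - by rewrite !halfplane_axis_slice.
  - by move=> t _; exact: halfplane_ge0.
  - by apply: measurable_funTS; exact: measurable_halfplane_line.
  - by move=> t _; exact: halfplane_ge0.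
  - by apply: measurable_funTS; exact: measurable_halfplane_line.
have axis_le (a : R) :
    Num.max 0 (a - p') + Num.max 0 (a - q') <= Num.max 0 (a - p) + Num.max 0 (a - q).
  by rewrite /Num.max; do 4 case: ifPn; rewrite -?leNgt; lra.
have area (x y a b : R) : 0 <= x -> 0 <= y ->
  (\int[lebesgue]_(v in `]0%R, b[)
    \int[lebesgue]_(u in `]0%R, a[) S x y (pos_inv u, pos_inv v) =
   (corner_area x y a b + corner_area y x a b)%:E)%E.
  move=> x0 y0; rewrite EFinD -!halfplane_area// -ge0_integralD//.
  - apply: eq_integral => v _; rewrite ge0_integralD//.
    + by move=> t _; exact: halfplane_ge0.
    + by apply: measurable_funTS; exact: measurable_halfplane_line.
    + by move=> t _; exact: halfplane_ge0.
    + by apply: measurable_funTS; exact: measurable_halfplane_line.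
  - by move=> v _; apply: integral_ge0 => t _; exact: halfplane_ge0.
  - by apply: measurable_funTS; exact: measurable_halfplane_slice.
  - by move=> v _; apply: integral_ge0 => t _; exact: halfplane_ge0.
  - by apply: measurable_funTS; exact: measurable_halfplane_slice.
have : (\int[nu]_s \int[nu]_t S p' q' (s, t) <= \int[nu]_s \int[nu]_t S p q (s, t))%E.
  apply: (inverted_concave_le_integral2 nuF) => //.
  - by rewrite /S /halfplane/= !mulr0.
  - by move=> a; rewrite !axis// lee_fin.
  - move=> b; have flip (x y : R) : (fun v => S x y (0, pos_inv v)) =
        (fun v => S x y (pos_inv v, 0)).
      by apply/funext => v; rewrite /S /halfplane/= !mulr0 !addr0 !add0r addeC.
    by rewrite !flip !axis// lee_fin.
  - by move=> a b; rewrite !area// lee_fin; exact: corner_area_spread.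
rewrite !intS leNgt; apply: contraNle => h.
by rewrite lteD.
Qed.

(** A positive level is scaled to 1. At a level c <= 0 the event forces both terms
    to vanish when X and Y are nonnegative, and the inclusion of events is
    pointwise. *)
Lemma pair_prob_spread p q p' q' c : 0 <= p -> p <= p' -> p' <= q' ->
  p + q = p' + q' -> (pair_prob p' q' c <= pair_prob p q c)%E.
Proof.
move=> p0 pp' pq' pq; have [c0|c0] := ltP 0 c.
  have norm (x y : R) : pair_prob x y c = pair_prob (x / c) (y / c) 1.
    apply: eq_integral => s _; apply: eq_integral => t _.
    rewrite /halfplane/=; congr ((_ : bool)%:R%:E).
    by rewrite -[in RHS](ler_pM2r c0) mul1r mulrDl mulrAC divfK ?gt_eqF//
      [y / c * t]mulrAC divfK ?gt_eqF.
  rewrite !norm; apply: pair_prob_spread1.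
  - by rewrite divr_ge0// ltW.
  - by rewrite ler_pM2r ?invr_gt0.
  - by rewrite ler_pM2r ?invr_gt0.
  - by rewrite -!mulrDl pq.
apply: le_integral_nonneg => //.
- by move=> s; apply: integral_ge0 => t _; exact: halfplane_ge0.
- by move=> s; apply: integral_ge0 => t _; exact: halfplane_ge0.
move=> s s0; apply: le_integral_nonneg => //.
- by move=> t; exact: halfplane_ge0.
- by move=> t; exact: halfplane_ge0.
move=> t t0; rewrite /halfplane/= lee_fin ler_nat.
case: (leP (p' * s + q' * t) c) => // h.
suff -> : p * s + q * t <= c by [].
have p'0 := le_trans p0 pp'; have q'0 := le_trans p'0 pq'.
have p's : 0 <= p' * s by rewrite mulr_ge0.
have q't : 0 <= q' * t by rewrite mulr_ge0.
have c_eq0 : c = 0 by lra.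
have q'tE : q' * t = 0 by lra.
have p'sE : p' * s = 0 by lra.
have psE : p * s = 0.
  by apply/eqP; rewrite eq_le mulr_ge0// andbT -p'sE ler_wpM2r.
have p't : p' * t = 0.
  by apply/eqP; rewrite eq_le mulr_ge0// andbT -q'tE ler_wpM2r.
have : q * t = (p' + q' - p) * t by rewrite -pq; ring.
have pt : 0 <= p * t by rewrite mulr_ge0.
lra.
Qed.

End weighted_pair.

(** * Independence and reduction to two summands *)

Section joint_law.
Context d d1 d2 (T : measurableType d) (T1 : measurableType d1)
  (T2 : measurableType d2) (R : realType) (P : probability T R).
Local Open Scope ereal_scope.

(** The product rule on rectangles determines the joint law, here on an event E
    that stands for the conditions imposed on the remaining variables. *)
Lemma joint_law_within (m1 : probability T1 R) (m2 : probability T2 R)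
    (Y : T -> T1) (Z : T -> T2) (E : set T) :
  measurable_fun [set: T] Y -> measurable_fun [set: T] Z -> measurable E ->
  (forall A B, measurable A -> measurable B ->
     P (Y @^-1` A `&` Z @^-1` B `&` E) = m1 A * m2 B * P E) ->
  forall C, measurable C ->
    P ((fun w => (Y w, Z w)) @^-1` C `&` E) = (m1 \x m2) C * P E.
Proof.
move=> mY mZ mE YZ C mC.
have PE0 : (0 <= fine (P E))%R by rewrite fine_ge0.
have PEfin : P E = (fine (P E))%:E by rewrite fineK// fin_num_measure.
have mYZ : measurable_fun [set: T] (fun w => (Y w, Z w)).
  exact: measurable_fun_pair.
pose m2E := mscale (NngNum PE0) m2.
transitivity ((m1 \x m2E) C).
  apply/esym.
  apply: (@product_measure_unique _ _ _ _ R m1 m2E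
    (pushforward (mrestr P mE) (fun w => (Y w, Z w)))) => // A B mA mB.
  by rewrite /= /m2E /mscale/= -PEfin muleA [_ * P E]muleC -muleA [RHS]muleC -YZ//.
rewrite /product_measure1/= muleC [in RHS]PEfin -ge0_integralZl//.
exact: measurable_fun_xsection.
Qed.

Lemma joint_law_section (m1 : probability T1 R) (m2 : probability T2 R)
    (Y : T -> T1) (Z : T -> T2) :
  measurable_fun [set: T] Y -> measurable_fun [set: T] Z ->
  (forall A B, measurable A -> measurable B ->
     P (Y @^-1` A `&` Z @^-1` B) = m1 A * m2 B) ->
  forall C, measurable C ->
    P ((fun w => (Y w, Z w)) @^-1` C) = \int[m2]_z m1 (ysection C z).
Proof.
move=> mY mZ YZ C mC.
rewrite -[X in P X]setIT (joint_law_within (m1 := m1) (m2 := m2))//; last first.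
  by move=> A B mA mB; rewrite setIT probability_setT mule1 YZ.
rewrite probability_setT mule1.
transitivity (\int[m1 \x m2]_z (\1_C z)%:E).
  by rewrite integral_indic// setIT.
rewrite fubini_tonelli2//; last exact/measurable_EFinP/measurable_indic.
by rewrite -[fubini_G _ _]/(fubini_G m1 (EFin \o \1_C)) indic_fubini_tonelli_GE.
Qed.

(** Stated for a probability so that it applies to products of probabilities. *)
Lemma measurable_section_probability (m1 : probability T1 R) (C : set (T1 * T2)) :
  measurable C -> measurable_fun [set: T2] (fun z => m1 (ysection C z)).
Proof. exact: (measurable_fun_ysection m1). Qed.

End joint_law.

Section partial_sums.
Context d (T : measurableType d) (R : realType) (P : probability T R)
  (I : finType) (X : I -> {RV P >-> R}).
Hypothesis indX : independent_RVs X.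
Variable a : I -> R.

Definition partial_sum (s : seq I) (w : T) : R := \sum_(k <- s) a k * X k w.

Lemma measurable_partial_sum s : measurable_fun [set: T] (partial_sum s).
Proof. by apply: measurable_sum => k; exact: measurable_funM. Qed.

HB.instance Definition _ s :=
  isMeasurableFun.Build _ _ _ _ (partial_sum s) (measurable_partial_sum s).

Let event (J : {set I}) (B : I -> set R) : set T :=
  \bigcap_(i in [set i | i \in J]) (X i @^-1` B i).

Let event_set0 B : event finset.set0 B = [set: T].
Proof. by apply/seteqP; split=> // w _ i; rewrite /= inE. Qed.

Let event_setU1 (k : I) (J : {set I}) (B : I -> set R) (A : set R) : k \notin J ->
  event (k |: J)%SET (fun i : I => if i == k then A else B i) =
  X k @^-1` A `&` event J B.
Proof.
move=> kJ; apply/seteqP; split=> w /=.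
  move=> h; split; first by have := h k; rewrite /= setU11 eqxx; exact.
  move=> i /= iJ; have := h i; rewrite /= in_setU1 iJ orbT.
  by case: eqVneq iJ => [->|_ _]; [rewrite (negbTE kJ)|exact].
move=> [Ak BJ] i /=; rewrite in_setU1; case: eqVneq => [->//|_ /= iJ].
exact: BJ.
Qed.

Let measurable_event (J : {set I}) (B : I -> set R) :
  (forall i, measurable (B i)) -> measurable (event J B).
Proof.
move=> mB; apply: fin_bigcap_measurable; first exact: finite_finset.
by move=> i _; rewrite -[X in measurable X]setTI; exact: measurable_funP.
Qed.

(** Summands are absorbed one at a time: X k and the sum over s are independent
    within any event on the other variables, hence so is their combination. The
    statement carries arbitrary events on variables outside s to make this
    induction work. *)
Lemma partial_sum_indep (s : seq I) (J : {set I}) (A : set R) (B : I -> set R) :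
  uniq s -> {in s, forall k, k \notin J} ->
  measurable A -> (forall i, measurable (B i)) ->
  (P (partial_sum s @^-1` A `&` event J B) =
   P (partial_sum s @^-1` A) * P (event J B))%E.
Proof.
elim: s J A B => [|k s IHs] J A B /=.
  move=> _ _ _ _; have [A0|nA0] := pselect (A 0).
    rewrite (_ : partial_sum [::] @^-1` A = [set: T]).
      by rewrite setTI probability_setT mul1e.
    by apply/seteqP; split=> // w _; rewrite /= /partial_sum big_nil.
  rewrite (_ : partial_sum [::] @^-1` A = set0).
    by rewrite set0I measure0 mul0e.
  by apply/seteqP; split=> // w /=; rewrite /partial_sum big_nil.
move=> /andP[ks us] ksJ mA mB.
have kJ : k \notin J by apply: ksJ; rewrite mem_head.
pose D : set (R * R) := (fun z => a k * z.1 + z.2) @^-1` A.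
have mD : measurable D.
  rewrite -[D]setTI; apply: (_ : measurable_fun _ _) => //.
  by apply: measurable_funD => //; exact: measurable_funM.
have sumE : partial_sum (k :: s) @^-1` A =
    (fun w => (X k w, partial_sum s w)) @^-1` D.
  by apply/seteqP; split=> w; rewrite /= /D /partial_sum big_cons.
have joint (J' : {set I}) : k \notin J' -> {in s, forall i, i \notin J'} ->
   (P (partial_sum (k :: s) @^-1` A `&` event J' B) =
    (distribution P (X k) \x distribution P (partial_sum s))%E D * P (event J' B))%E.
  move=> kJ' sJ'; rewrite sumE.
  apply: joint_law_within => //; first exact: measurable_event.
  move=> A1 B1 mA1 mB1.
  rewrite [X in P (X `&` _)]setIC -setIA -event_setU1// IHs//.
  - rewrite -muleA muleCA; congr (_ * _)%E.
    have Ek : (P (X k @^-1` A1 `&` event J' B) =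
        distribution P (X k) A1 * P (event J' B))%E.
      rewrite -event_setU1// !indX//.
        rewrite big_setU1//= eqxx; congr (_ * _)%E.
        by apply: eq_bigr => i iJ'; case: eqVneq iJ' => // ->; rewrite (negbTE kJ').
      by move=> i; case: ifP.
    by rewrite -Ek event_setU1.
  - move=> i is_; rewrite in_setU1 negb_or sJ'// andbT.
    by apply: contraNneq ks => <-.
  - by move=> i; case: ifP.
have := joint finset.set0; rewrite event_set0 setIT probability_setT mule1 => ->; last 2 first.
- by rewrite inE.
- by move=> i _; rewrite inE.
by apply: joint => // i is_; apply: ksJ; rewrite in_cons is_ orbT.
Qed.

End partial_sums.

Section split_pair.
Context d (T : measurableType d) (R : realType) (P : probability T R)
  (I : finType) (X : I -> {RV P >-> R}) (nu : probability R R).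
Hypothesis indX : independent_RVs X.
Hypothesis lawX : forall i A, measurable A -> P (X i @^-1` A) = nu A.

Definition rest (i j : I) : seq I := [seq k <- enum I | (k != i) && (k != j)].

Lemma sum_rest (f : I -> R) i j : i != j ->
  \sum_k f k = f i + f j + \sum_(k <- rest i j) f k.
Proof.
move=> ij; rewrite (bigD1 i)//= (bigD1 j) 1?eq_sym//= addrA; congr (_ + _).
by rewrite /rest big_filter big_enum_cond.
Qed.

Definition halfspace (p q c : R) : set ((R * R) * R) :=
  [set z | p * z.1.1 + q * z.1.2 + z.2 <= c].

Lemma measurable_halfspace p q c : measurable (halfspace p q c).
Proof.
rewrite (_ : halfspace p q c = [set: (R * R) * R] `&`
  (fun z => p * z.1.1 + q * z.1.2 + z.2 <= c) @^-1` [set true]); last first.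
  by rewrite setTI.
have m11 : measurable_fun [set: (R * R) * R] (fun z => z.1.1).
  exact: measurableT_comp.
have m12 : measurable_fun [set: (R * R) * R] (fun z => z.1.2).
  exact: measurableT_comp.
suff mb : measurable_fun [set: (R * R) * R]
    (fun z => p * z.1.1 + q * z.1.2 + z.2 <= c) by exact: mb.
apply: measurable_fun_ler => //; apply: measurable_funD => //.
by apply: measurable_funD; exact: measurable_funM.
Qed.

Lemma halfspace_section p q c s :
  ((nu \x nu)%E (ysection (halfspace p q c) s) = pair_prob nu p q (c - s))%E.
Proof.
rewrite -(setIT (ysection _ s)) -[LHS]integral_indic ?setIT//; last first.
  by apply: measurable_ysection; exact: measurable_halfspace.
rewrite /pair_prob -(fubini_tonelli1 (halfplane p q (c - s))); last 2 first.
- exact: measurable_halfplane.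
- exact: halfplane_ge0.
apply: eq_integral => z _; rewrite /halfplane indicE mem_ysection /halfspace.
by rewrite mem_setE/= lerBrDr.
Qed.

Lemma measurable_pair_prob p q c :
  measurable_fun [set: R] (fun s => pair_prob nu p q (c - s)).
Proof.
apply: (eq_measurable_fun (fun s => (nu \x nu)%E (ysection (halfspace p q c) s))).
  by move=> s _; exact: halfspace_section.
apply: (measurable_section_probability (nu \x nu)%E).
exact: measurable_halfspace.
Qed.

(** Conditioning on the sum of the other terms. *)
Lemma weighted_sum_split (a : I -> R) (i j : I) (c : R) : i != j ->
  (P [set w | (\sum_k a k * X k w <= c)%R] =
   \int[distribution P (partial_sum X a (rest i j))]_s
     pair_prob nu (a i) (a j) (c - s))%E.
Proof.
move=> ij; set S := partial_sum X a (rest i j).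
have uS : uniq (rest i j) by rewrite filter_uniq// enum_uniq.
have mS : measurable_fun [set: T] S by exact: measurable_partial_sum.
have mXinv k (A : set R) : measurable A -> measurable (X k @^-1` A).
  by move=> mA; rewrite -[X in measurable X]setTI; exact: measurable_funP.
have mSinv (A : set R) : measurable A -> measurable (S @^-1` A).
  by move=> mA; rewrite -[X in measurable X]setTI; exact: mS.
have ijS k : k \in rest i j -> k \notin [set i; j]%SET.
  by rewrite mem_filter in_set2 negb_or => /andP[].
have pairE (A B : set R) : \bigcap_(k in [set k | k \in [set i; j]%SET])
    (X k @^-1` (if k == i then A else B)) = X i @^-1` A `&` X j @^-1` B.
  apply/seteqP; split=> w /=.
    move=> h; split; first by have := h i; rewrite /= set21 eqxx; exact.
    by have := h j; rewrite /= set22 [j == i]eq_sym (negbTE ij); exact.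
  move=> [Ai Bj] k /=; rewrite in_set2; case: eqVneq => [->//|_ /= /eqP ->].
  exact: Bj.
have pairP (A B : set R) : measurable A -> measurable B ->
    (P (X i @^-1` A `&` X j @^-1` B) = nu A * nu B)%E.
  move=> mA mB; rewrite -pairE indX; last by move=> k; case: ifP.
  rewrite big_setU1; last by rewrite finset.in_set1.
  by rewrite finset.big_set1 eqxx [j == i]eq_sym (negbTE ij)/= !lawX.
have joint3 (A B C : set R) : measurable A -> measurable B -> measurable C ->
    (P (X i @^-1` A `&` X j @^-1` B `&` S @^-1` C) = nu A * nu B * P (S @^-1` C))%E.
  move=> mA mB mC; rewrite setIC -pairE partial_sum_indep//.
  - by rewrite pairE pairP// muleC.
  - by move=> k; case: ifP.
have mXX : measurable_fun [set: T] (fun w => (X i w, X j w)).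
  exact: measurable_fun_pair.
have jointXX (D : set (R * R)) (C : set R) : measurable D -> measurable C ->
    (P ((fun w => (X i w, X j w)) @^-1` D `&` S @^-1` C) =
     (nu \x nu) D * distribution P S C)%E.
  by move=> mD mC; apply: joint_law_within => //; [exact: mSinv|move=> *; exact: joint3].
transitivity (P ((fun w => ((X i w, X j w), S w)) @^-1` halfspace (a i) (a j) c)).
  congr (P _); apply/seteqP; split=> w;
    by rewrite /halfspace/= /S/= /partial_sum (sum_rest _ ij).
rewrite (joint_law_section (m1 := (nu \x nu)%E) (m2 := distribution P S))//.
  by apply: eq_integral => s _; exact: halfspace_section.
exact: measurable_halfspace.
Qed.

End split_pair.

(** * Spreading two weights in a weighted sum *)

Section inverted_concave_law.
Context {R : realType}.

Lemma probability_eq_cdf (m1 m2 : probability R R) :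
  (forall x : R, m1 `]-oo, x]%classic = m2 `]-oo, x]%classic) ->
  forall A, measurable A -> m1 A = m2 A.
Proof.
move=> m12.
have tail (m : probability R R) (x : R) :
    (m `]x, +oo[%classic = 1 - m `]-oo, x]%classic)%E.
  by rewrite -setCitvl probability_setC.
apply: (measure_unique (@RGenOInfty.G R) (fun n => `](- n%:R), +oo[%classic)).
- exact: RGenOInfty.measurableE.
- move=> _ _ [x ->] [y ->]; exists (Num.max x y).
  apply/seteqP; split=> u /=; rewrite !in_itv/= !andbT gt_max.
    by move=> [-> ->].
  by move=> /andP[].
- by move=> n; exists (- n%:R).
- rewrite -subTset => x _; exists (Num.truncn (- x)).+1 => //=.
  by rewrite in_itv/= andbT ltrNl truncnS_gt.
- by move=> _ [x ->]; rewrite [LHS]tail [RHS]tail m12.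
- by move=> n; rewrite (le_lt_trans (probability_le1 m1 _)) ?ltry.
Qed.

Variable F : cumulativeBounded (0 : R) (1 : R).

Let idTR : measurableTypeR R -> R := idfun.

#[local] HB.instance Definition _ :=
  @isMeasurableFun.Build _ _ _ _ idTR (@measurable_id _ _ setT).

(** The Lebesgue-Stieltjes measure of F, transported by the identity to the
    canonical measurable structure of R. *)
Definition law_of_df : probability R R :=
  distribution (lebesgue_stieltjes_measure F) (idTR : {mfun _ >-> R}).
Let nu := law_of_df.

Lemma law_of_df_cdf (x : R) : nu `]-oo, x]%classic = (F x)%:E.
Proof. exact: cdf_lebesgue_stieltjes_id. Qed.

Hypothesis Fic : inverted_concave F.

Lemma inverted_concave_slope (w u v : R) : 0 < w -> w < u -> u < v ->
  ((1 - F v^-1) - (1 - F u^-1)) / (v - u) <= ((1 - F u^-1) - (1 - F w^-1)) / (u - w).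
Proof.
move=> w0 wu uv; have wv := lt_trans wu uv.
have vw0 : 0 < v - w by rewrite subr_gt0.
have uw0 : 0 < u - w by rewrite subr_gt0.
have vu0 : 0 < v - u by rewrite subr_gt0.
have t0 : 0 <= (v - u) / (v - w) by rewrite divr_ge0// ltW.
have t1 : (v - u) / (v - w) <= 1 by rewrite ler_pdivrMr// mul1r; lra.
have uE : (v - u) / (v - w) * w + (1 - (v - u) / (v - w)) * v = u.
  by field; rewrite gt_eqF.
have [_ /(_ (Itv01 t0 t1) w v)] := Fic.
rewrite !inE/= => /(_ w0 (lt_trans w0 wv)).
rewrite !convRE/= /unstable.onem.
(* restated with the convex combination of w and v written out *)
move=> h; have {}h : (v - u) / (v - w) * (1 - F w^-1) +
    (1 - (v - u) / (v - w)) * (1 - F v^-1) <=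
    1 - F ((v - u) / (v - w) * w + (1 - (v - u) / (v - w)) * v)^-1 := h.
move: h; rewrite uE.
set A := 1 - F w^-1; set B := 1 - F v^-1; set C := 1 - F u^-1 => h.
have {}h : (v - u) * A + (u - w) * B <= C * (v - w).
  rewrite -ler_pdivrMr//; apply: le_trans h; rewrite le_eqVlt; apply/orP; left.
  by apply/eqP; field; rewrite gt_eqF.
rewrite ler_pdivrMr// mulrAC ler_pdivlMr//; nra.
Qed.

Lemma inverted_concave_neg0 : nu `]-oo, 0[%classic = 0%E.
Proof.
have [ess0 _] := Fic.
have : (\forall x \ae lebesgue_stieltjes_measure F, (0%E <= x%:E)%E).
  by rewrite -ess0; exact: ess_inf_le.
move=> [N [mN N0 subN]].
apply/eqP; rewrite eq_le measure_ge0 andbT -N0.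
apply: le_measure; rewrite ?inE//.
move=> x /=; rewrite in_itv/= => x0; apply: subN => /=.
by rewrite lee_fin leNgt x0.
Qed.

End inverted_concave_law.

Section spread_pair.
Context d (T : measurableType d) (R : realType) (P : probability T R)
  (I : finType) (X : I -> {RV P >-> R}) (F : cumulativeBounded (0 : R) (1 : R)).
Hypotheses (Fic : inverted_concave F) (iidX : iid_with_df F X).

(** The conditions on b i and b j say that both lie between a i and a j, in either
    order; exchanging the two weights is thus allowed. *)
Lemma weighted_sum_spread (a b : I -> R) (i j : I) (c : R) : i != j ->
  (forall k, k != i -> k != j -> a k = b k) ->
  0 <= a i -> 0 <= a j -> a i + a j = b i + b j ->
  Num.min (a i) (a j) <= b i -> Num.min (a i) (a j) <= b j ->
  (P [set w | (\sum_k b k * X k w <= c)%R] <=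
   P [set w | (\sum_k a k * X k w <= c)%R])%E.
Proof.
move=> ij ab ai0 aj0 abE minbi minbj.
pose nu := law_of_df F.
have [indX cdfX] := iidX.
have lawX k A : measurable A -> P (X k @^-1` A) = nu A.
  move=> mA; apply: (probability_eq_cdf (m1 := distribution P (X k)) (m2 := nu)) => // x.
  by rewrite law_of_df_cdf; exact: cdfX.
rewrite !(weighted_sum_split indX lawX _ _ ij).
have eqS : partial_sum X b (rest i j) = partial_sum X a (rest i j) :> (T -> R).
  apply/funext => w; apply: eq_big_seq => k.
  by rewrite mem_filter => /andP[/andP[ki kj] _]; rewrite ab.
rewrite (eq_measure_integral (distribution P (partial_sum X a (rest i j)))); last first.
  move=> A mA _; transitivity (P (partial_sum X b (rest i j) @^-1` A)) => //.
  by rewrite eqS.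
have spread p q p' q' e := @pair_prob_spread R nu F (law_of_df_cdf F)
  (inverted_concave_slope Fic) (inverted_concave_neg0 Fic) p q p' q' e.
have ge0 x y e : (0 <= pair_prob nu x y e)%E.
  apply: integral_ge0 => s _; apply: integral_ge0 => t _; exact: halfplane_ge0.
apply: ge0_le_integral => //; [exact: measurable_pair_prob..|].
move=> s _.
have [aij|/ltW aji] := leP (a i) (a j).
  rewrite min_l// in minbi minbj.
  have [bij|/ltW bji] := leP (b i) (b j); first exact: spread.
  by rewrite [leLHS]pair_probC; apply: spread => //; rewrite abE addrC.
rewrite min_r// in minbi minbj; rewrite [leRHS]pair_probC.
have [bij|/ltW bji] := leP (b i) (b j); first by apply: spread; rewrite // addrC.
by rewrite [leLHS]pair_probC; apply: spread => //; rewrite addrC abE addrC.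
Qed.

End spread_pair.

(** * Majorization by transfers *)

Section majorization_transfers.
Context {R : realType} {n : nat} (Phi : ('I_n -> R) -> \bar R).
Implicit Types v eta theta : 'I_n -> R.

Hypothesis Phi_transfer : forall (a b : 'I_n -> R) (i j : 'I_n), i != j ->
  (forall k, k != i -> k != j -> a k = b k) ->
  0 <= a i -> 0 <= a j -> a i + a j = b i + b j ->
  Num.min (a i) (a j) <= b i -> Num.min (a i) (a j) <= b j ->
  (Phi b <= Phi a)%E.

(** Exchanging two coordinates is a transfer, and transpositions generate all
    permutations. *)
Lemma transfer_perm v (s : 'S_n) : (forall i, 0 <= v i) ->
  (Phi (fun i => v (s i)) <= Phi v)%E.
Proof.
move=> v0; have [ts -> _] := prod_tpermP s.
elim: ts v v0 => [|t ts IH] v v0.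
  rewrite big_nil; have -> // : (fun i => v ((1%g : 'S_n) i)) = v.
  by apply/funext => i; rewrite perm1.
rewrite big_cons; apply: le_trans (IH v v0).
set p := (\prod_(t' <- ts) _)%g; pose w i := v (p i).
rewrite (_ : (fun _ => _) = fun i => w (tperm t.1 t.2 i)); last first.
  by apply/funext => i; rewrite permM.
have [t12|t12] := eqVneq t.1 t.2.
  rewrite (_ : (fun _ => _) = w)// t12.
  by apply/funext => i; rewrite tperm1 perm1.
apply: (Phi_transfer t12); rewrite ?tpermL ?tpermR ?v0//.
- by move=> k k1 k2; rewrite tpermD// eq_sym.
- by rewrite addrC.
- by rewrite ge_min lexx orbT.
- by rewrite ge_min lexx.
Qed.

(** Let k be the first index with theta k < eta k. The prefix condition at k gives
    j < k with eta j < theta j, and eta j < theta j <= theta k < eta k since theta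
    is sorted. Moving from k to j the smaller of the two gaps makes one more
    coordinate of eta agree with theta; prefixes stay dominated because eta <= theta
    before k. The induction then goes on with the modified eta, on whose order
    nothing is assumed. *)
Lemma transfer_majorized theta eta :
  (forall i j : 'I_n, (i <= j)%N -> theta i <= theta j) ->
  (forall i, 0 <= eta i) ->
  (forall m, (m <= n)%N ->
     \sum_(i < n | (i < m)%N) eta i <= \sum_(i < n | (i < m)%N) theta i) ->
  \sum_i theta i = \sum_i eta i ->
  (Phi theta <= Phi eta)%E.
Proof.
move=> theta_nd.
move: {2}#|_|.+1 (ltnSn #|[set i | theta i != eta i]|%SET) => N.
elim: N eta => // N IH eta; rewrite ltnS => card_diff eta0 prefix total.
have [/existsP[k0 k0P]|/existsPn noP] := boolP [exists k, theta k < eta k]; last first.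
  have le_eta i : eta i <= theta i by rewrite leNgt noP.
  suff -> : eta = theta by [].
  apply/funext => i; apply/eqP; rewrite -subr_eq0; apply/eqP/oppr_inj.
  rewrite opprB oppr0; apply: (psumr_eq0P (P := xpredT) (F := fun i => theta i - eta i)) => //.
    by move=> j _; rewrite subr_ge0.
  by rewrite sumrB total subrr.
have [k ltk mink] := @arg_minnP _ k0 (fun k => theta k < eta k) (@nat_of_ord n) k0P.
have before_k (i : 'I_n) : (i < k)%N -> eta i <= theta i.
  by move=> ik; rewrite leNgt; apply/negP => /mink; rewrite leqNgt ik.
have [j /andP[jk ltj]] : exists j : 'I_n, (j < k)%N && (eta j < theta j).
  apply/existsP; apply: contraT => /existsPn noj.
  have := prefix k.+1 (ltn_ord k).
  rewrite (bigD1 k)//= [leRHS](bigD1 k)//= leNgt ltr_leD//.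
  apply: ler_sum => i /andP[ik ik']; have := noj i.
  by rewrite ltn_neqAle ik' -ltnS ik /= -leNgt.
have jk' : j != k by apply: contraTneq jk => ->; rewrite ltnn.
pose dl := Num.min (theta j - eta j) (eta k - theta k).
have dl0 : 0 <= dl by rewrite le_min !subr_ge0 !ltW.
have dlj : dl <= theta j - eta j by rewrite ge_min lexx.
have dlk : dl <= eta k - theta k by rewrite ge_min lexx orbT.
pose eta' i := eta i + dl * (i == j)%:R - dl * (i == k)%:R.
have eta'j : eta' j = eta j + dl.
  by rewrite /eta' eqxx (negbTE jk') mulr1 mulr0 subr0.
have eta'k : eta' k = eta k - dl.
  by rewrite /eta' eqxx eq_sym (negbTE jk') mulr1 mulr0 addr0.
have eta'E i : i != j -> i != k -> eta' i = eta i.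
  by move=> /negbTE ij /negbTE ik; rewrite /eta' ij ik !mulr0 subr0 addr0.
have thjk : theta j <= theta k by rewrite theta_nd// ltnW.
have etajk : eta j <= eta k by rewrite (le_trans (ltW ltj))// (le_trans thjk)// ltW.
have sum_delta (Q : pred 'I_n) (l : 'I_n) :
    \sum_(i < n | Q i) dl * (i == l)%:R = dl * (Q l)%:R.
  rewrite -mulr_sumr big_mkcond (bigD1 l)//= eqxx big1 ?addr0.
    by case: (Q l).
  by move=> i /negbTE ->; case: ifP.
have sum_eta' (Q : pred 'I_n) : \sum_(i < n | Q i) eta' i =
    \sum_(i < n | Q i) eta i + dl * (Q j)%:R - dl * (Q k)%:R.
  by rewrite /eta' sumrB big_split/= !sum_delta.
apply: (@le_trans _ _ (Phi eta')); last first.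
  apply: (Phi_transfer jk') => //.
  - by move=> i ij ik; rewrite eta'E.
  - by rewrite eta'j eta'k; ring.
  - by rewrite min_l// eta'j lerDl.
  - by rewrite min_l// eta'k; lra.
apply: IH.
- apply: leq_trans card_diff; apply: proper_card; apply/properP; split.
    apply/fintype.subsetP => i; rewrite !inE.
    have [->|ij] := eqVneq i j; first by move=> _; rewrite gt_eqF.
    have [->|ik] := eqVneq i k; first by move=> _; rewrite lt_eqF.
    by rewrite eta'E.
  have [jk_le|kj_lt] := leP (theta j - eta j) (eta k - theta k).
    exists j; first by rewrite inE gt_eqF.
    rewrite inE negbK eta'j /dl min_l//.
    by apply/eqP; lra.
  exists k; first by rewrite inE lt_eqF.
  rewrite inE negbK eta'k /dl min_r ?ltW//.
  by apply/eqP; lra.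
- move=> i; have [->|ij] := eqVneq i j; first by rewrite eta'j addr_ge0.
  have [->|ik] := eqVneq i k; last by rewrite eta'E.
  have := eta0 j; rewrite eta'k; lra.
- move=> m mn; rewrite sum_eta'.
  have [mk|km] := leqP m k; last first.
    by rewrite (ltn_trans jk km) addrK prefix.
  rewrite mulr0 subr0; have [mj|jm] := leqP m j.
    by rewrite mulr0 addr0 prefix.
  rewrite mulr1 -lerBrDl -sumrB (bigD1 j)//= (le_trans dlj)// lerDl.
  apply: sumr_ge0 => i /andP[im _].
  by rewrite subr_ge0 before_k// (leq_trans im).
- by rewrite sum_eta' mulr1 addrK.
Qed.

End majorization_transfers.

(** * Stochastic dominance under majorization *)

Lemma order_stats_perm (R : realType) (n : nat) (v : 'rV[R]_n) :
  exists s : 'S_n, forall i : 'I_n, nth 0 (order_stats v) i = v 0 (s i).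
Proof.
have /tuple_permP[s vs] : perm_eq (order_stats v) [tuple v 0 i | i < n].
  by rewrite /order_stats perm_sort.
by exists s => i; rewrite vs -tnth_nth !tnth_mktuple.
Qed.

Lemma order_stats_nd (R : realType) (n : nat) (v : 'rV[R]_n) (i j : 'I_n) :
  (i <= j)%N -> nth 0 (order_stats v) i <= nth 0 (order_stats v) j.
Proof.
have sz : size (order_stats v) = n by rewrite size_sort size_map size_enum_ord.
apply: (sorted_leq_nth le_trans lexx); rewrite ?inE ?sz//.
exact: sort_le_sorted.
Qed.

Theorem theorem1 (R : realType) (F : cumulativeBounded (0 : R) (1 : R)) :
  inverted_concave F -> property_SD F.
Proof.
move=> Fic n d T P X _ iidX theta eta theta0 eta0 [prefix total] c.
pose Phi (a : 'I_n -> R) := P [set w | \sum_k a k * X k w <= c].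
have cdfE (a : 'rV[R]_n) :
    cdf (weighted_sum a X : {RV P >-> R}) c = Phi (fun i => a 0 i).
  by rewrite /cdf /distribution /pushforward /Phi; congr (P _).
rewrite !cdfE.
have transfer (a b : 'I_n -> R) (i j : 'I_n) : i != j ->
    (forall k, k != i -> k != j -> a k = b k) ->
    0 <= a i -> 0 <= a j -> a i + a j = b i + b j ->
    Num.min (a i) (a j) <= b i -> Num.min (a i) (a j) <= b j ->
    (Phi b <= Phi a)%E.
  exact: (weighted_sum_spread Fic iidX).
have [s thetaE] := order_stats_perm theta.
have [t etaE] := order_stats_perm eta.
pose th i := theta 0 (s i); pose et i := eta 0 (t i).
apply: (@le_trans _ _ (Phi th)).
  rewrite (_ : (fun i => theta 0 i) = fun i => th ((s^-1)%g i)).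
    by apply: transfer_perm => // i; exact: theta0.
  by apply/funext => i; rewrite /th permKV.
apply: (@le_trans _ _ (Phi et)); last exact: (transfer_perm transfer).
apply: (transfer_majorized transfer).
- by move=> i j ij; rewrite /th -!thetaE order_stats_nd.
- by move=> i; exact: eta0.
- move=> [|m] mn; first by rewrite !big_pred0.
  have := prefix m.+1 mn.
  rewrite !(big_ord_widen n (fun i => nth 0 (order_stats _) i) mn).
  by under eq_bigr do rewrite etaE; under [leRHS]eq_bigr do rewrite thetaE.
- have -> : \sum_i th i = \sum_i theta 0 i.
    by rewrite [RHS](reindex_inj (@perm_inj _ s)).
  by rewrite total [LHS](reindex_inj (@perm_inj _ t)).
Qed.
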